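(* Let $G$ be a planar graph with maximum degree $\Delta$. (1) If $\Delta\geq 11$, then $\chi'_{gl}(G)\leq \Delta+1$. (2) If $\Delta\geq 10$, then $\chi'_{gl}(G)\leq \Delta+2$.
   Context: All graphs are finite and simple. $\ell(G)$ denotes the line graph of $G$ (its vertices are the edges of $G$, two being adjacent iff they share an endpoint in $G$). Let $H$ be a graph with a fixed orientation of its edges, $A$ an Abelian group, $L:V(H)\to 2^A$ a list assignment and $f:E(H)\to A$. An $(A,L,f)$-coloring of $H$ is a map $c:V(H)\to A$ with $c(v)\in L(v)$ for every vertex $v$ and $c(x)-c(y)\neq f(xy)$ for every edge $xy$ directed from $x$ to $y$. $H$ is $(A,L)$-colorable if it has an $(A,L,f)$-coloring for every $f:E(H)\to A$ (this does not depend on the orientation). $H$ is $k$-group choosable if it is $(A,L)$-colorable for every Abelian group $A$ of order at least $k$ and every $L$ with $|L(v)|=k$ for all $v\in V(H)$. $\chi_{gl}(H)$ is the smallest $k$ such that $H$ is $k$-group choosable. $G$ is edge-$k$-group choosable if $\ell(G)$ is $k$-group choosable, and $\chi'_{gl}(G)=\chi_{gl}(\ell(G))$. *)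

(* Defs.v *)
From HB Require Import structures.
From mathcomp Require Import all_boot all_order all_algebra.
From mathcomp Require Import all_classical all_reals all_analysis.

Set Implicit Arguments.
Unset Strict Implicit.
Unset Printing Implicit Defensive.

Import Order.TTheory GRing.Theory Num.Theory.
Import numFieldNormedType.Exports.

Local Open Scope classical_set_scope.
Local Open Scope ring_scope.

Record sgraph := SGraph {
  svertex :> finType;
  sedge : rel svertex;
  sedge_sym : symmetric sedge;
  sedge_irrefl : irreflexive sedge }.

Definition edge_set (G : sgraph) : {set {set G}} :=
  [set e : {set G} | [exists x : G, [exists y : G,
     sedge x y && (e == [set x; y]%SET)]]]%SET.

Definition edge_of (G : sgraph) : finType := {e : {set G} | e \in edge_set G}.

Definition degree (G : sgraph) (x : G) : nat := #|[pred y | sedge x y]|.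

Definition max_degree (G : sgraph) : nat := (\max_(x : G) degree x)%N.

Definition line_adj (G : sgraph) : rel (edge_of G) :=
  fun e f => (e != f) && [exists x : G, (x \in val e) && (x \in val f)].

Lemma line_adj_sym (G : sgraph) : symmetric (@line_adj G).
Proof.
move=> e f; rewrite /line_adj eq_sym; congr (_ && _).
by apply: eq_existsb => x; rewrite andbC.
Qed.

Lemma line_adj_irrefl (G : sgraph) : irreflexive (@line_adj G).
Proof. by move=> e; rewrite /line_adj eqxx. Qed.

Definition line_graph (G : sgraph) : sgraph :=
  SGraph (@line_adj_sym G) (@line_adj_irrefl G).

(* A drawing of G in the plane R^2 without crossings: vertex v is the point
   p v, edge e is the simple arc gamma e restricted to [0, 1], which joins the
   points of its two endpoints; the interior of an arc contains no vertex and
   no interior point of another arc. *)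
Definition plane_drawing (R : realType) (G : sgraph)
    (p : G -> R * R) (gamma : edge_of G -> R -> R * R) : Prop :=
  [/\ injective p,
      forall e, {within `[0, 1], continuous (gamma e)}
                /\ {in `[0, 1] &, injective (gamma e)},
      forall e, gamma e @` [set 0; 1] = p @` [set x | x \in val e],
      forall e (t : R) v, 0 < t < 1 -> gamma e t <> p v
    & forall e f (s t : R), e != f -> 0 < s < 1 -> 0 < t < 1 ->
        gamma e s <> gamma f t].

Definition planar (R : realType) (G : sgraph) : Prop :=
  exists p gamma, @plane_drawing R G p gamma.

Definition orientation (H : sgraph) (D : rel H) : Prop :=
  (forall x y, D x y -> sedge x y)
  /\ (forall x y, sedge x y -> D x y = ~~ D y x).

Definition group_coloring (H : sgraph) (D : rel H) (A : zmodType)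
    (L : H -> set A) (f : edge_of H -> A) (c : H -> A) : Prop :=
  (forall v, L v (c v))
  /\ (forall (e : edge_of H) (x y : H), D x y -> val e = [set x; y]%SET ->
        c x - c y <> f e).

(* The choice of the orientation is irrelevant (reversing an edge amounts to
   negating f on it), so all orientations are quantified over. *)
Definition group_colorable (H : sgraph) (A : zmodType) (L : H -> set A) : Prop :=
  forall D : rel H, orientation D ->
  forall f : edge_of H -> A, exists c : H -> A, group_coloring D L f c.

(* A may be infinite: "of order at least k" is a cardinal comparison. *)
Definition group_choosable (H : sgraph) (k : nat) : Prop :=
  forall A : zmodType, (`I_k #<= [set: A])%card ->
  forall L : H -> set A, (forall v, (L v #= `I_k)%card) -> group_colorable L.

Lemma card_le_seq (T : choiceType) (s : seq T) : ([set` s] #<= `I_(size s))%card.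
Proof.
case: s => [|x0 s]; first by rewrite set_nil card_ge0.
apply: card_le_trans (card_image_le (nth x0 (x0 :: s)) _).
apply: subset_card_le => x /= xs.
by exists (index x (x0 :: s)); [rewrite -index_mem in xs | exact: nth_index].
Qed.

Lemma group_choosable_card (H : sgraph) : group_choosable H #|H|.
Proof.
move=> A _ L cardL D [Dedge Dor] f.
have fresh (v : H) (s : seq A) : (size s < #|H|)%N ->
    exists2 a, L v a & a \notin s.
  move=> lt_s; apply: contrapT => no_a.
  have sub : L v `<=` [set` s].
    move=> a La /=; apply: contrapT => /negP nas.
    by apply: no_a; exists a.
  have /card_le_trans/(_ (card_le_seq s)) := subset_card_le sub.
  by rewrite (card_le_eql (cardL v)) card_le_II leqNgt lt_s.
have Dxx x : D x x = false.
  by apply/negP => /Dedge; rewrite sedge_irrefl.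
pose val_f x y := if [pick e : edge_of H | val e == [set x; y]%SET] is Some e
                  then f e else 0.
have val_fP (e : edge_of H) x y : val e = [set x; y]%SET -> val_f x y = f e.
  rewrite /val_f => exy; case: pickP => [e' /eqP e'xy|/(_ e)].
    by congr f; apply: val_inj; rewrite e'xy exy.
  by rewrite exy eqxx.
suff [c [cL cf]] : exists c : H -> A, (forall v, v \in enum H -> L v (c v)) /\
    forall x y, x \in enum H -> y \in enum H -> D x y -> c x - c y <> val_f x y.
  exists c; split=> [v|e x y Dxy exy]; first by apply: cL; rewrite mem_enum.
  by rewrite -(val_fP _ _ _ exy); apply: cf => //; rewrite mem_enum.
have : (size (enum H) <= #|H|)%N by rewrite -cardE.
elim: (enum H) (enum_uniq H) => [|v r IHr] /=; first by exists (fun=> 0).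
case/andP=> v_r r_uniq lt_r; have [c [cL cf]] := IHr r_uniq (ltnW lt_r).
pose bad y := if D v y then val_f v y + c y else c y - val_f y v.
have [|a La a_bad] := fresh v [seq bad y | y <- r]; first by rewrite size_map.
have badP y : y \in r -> a <> bad y.
  by move=> yr ay; case/mapP: a_bad; exists y.
have neq y : y \in r -> (y == v) = false.
  by move=> yr; apply: contraNF v_r => /eqP <-.
exists (fun x => if x == v then a else c x); split=> [x|x y].
  by rewrite inE; case: eqP => [-> //|_ /= /cL].
rewrite !inE; have [->|xv] /= := eqVneq x v; last first.
  move=> xr; have [->|yv] /= := eqVneq y v; last by move=> yr; apply: cf.
  move=> _ Dxv eqf; apply: (badP x xr).
  rewrite /bad; have := Dor _ _ (Dedge _ _ Dxv).
  by rewrite Dxv => /esym/negbTE ->; rewrite -eqf subKr.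
have [->|yv] /= := eqVneq y v; first by rewrite Dxx.
by move=> _ yr Dvy eqf; apply: (badP y yr); rewrite /bad Dvy -eqf subrK.
Qed.

Lemma group_choosable_ex (H : sgraph) :
  exists k, `[< group_choosable H k >].
Proof. by exists #|H|; apply/asboolP; exact: group_choosable_card. Qed.

Definition chi_gl (H : sgraph) : nat := ex_minn (group_choosable_ex H).

Definition edge_chi_gl (G : sgraph) : nat := chi_gl (line_graph G).

(* Main.v *)
Require Import Defs.
From mathcomp Require Import all_boot all_order all_algebra.
From mathcomp Require Import all_classical all_reals all_analysis.
From mathcomp Require Import zify ring lra.

Set Implicit Arguments.
Unset Strict Implicit.
Unset Printing Implicit Defensive.

Import Order.TTheory GRing.Theory Num.Theory.
Import numFieldNormedType.Exports.

(** Both bounds come from one fact about planar graphs, Kotzig's theorem in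
    Borodin's form: in a planar graph with at least one edge, some edge either
    has an end of degree at most 2 or has ends whose degrees add up to at most
    13 ([rotation_light_edge]).  Applied to the subgraph formed by any nonempty
    set W of edges of G, it gives an edge of W adjacent to at most
    max (Delta, 11) other edges of W.  So if k > Delta and k >= 12, the line
    graph can be coloured greedily from lists of size k: colour everything but
    such an edge first, and each coloured neighbour then forbids only one
    element of the group ([degenerate_group_choosable]).  Both k = Delta + 1
    with Delta >= 11 and k = Delta + 2 with Delta >= 10 qualify.

    Kotzig's theorem is proved by discharging on a rotation system.  Only the
    inequality V - E + F >= 1 is needed, where F counts the orbits of the face
    permutation phi, and it follows from a property of cycles: if every even
    edge set (mod 2 cycle) is the coboundary of a phi-invariant function, then
    the cycle space, of dimension at least E - V, lies in the image of the space of
    invariant functions, of dimension F, under a map that kills the constants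
    ([euler_inequality]).

    The drawing is turned into such a rotation system without the Jordan curve
    theorem.  Cut each arc into thirds, and group the outer thirds by the vertex
    where they start.  Disjoint compact sets are a positive distance apart, so
    on a fine square grid the grid points near these sets exhibit G as a minor
    of the grid: disjoint connected blobs of grid points, one for each vertex,
    with adjacent blobs for adjacent vertices ([grid_traces],
    [grid_minor_of_regions], [planar_grid_minor]).  In the grid an even edge set
    is explicitly a coboundary: the value at a unit cell is the parity of the
    number of its edges met by a horizontal ray from the cell
    ([grid_coboundary]).  Walking around a spanning tree of each blob orders the
    edges that leave it, which defines the rotation system of G, and both the
    lifting of even edge sets from G to the grid and the invariance of the cell
    function along faces can be checked there ([grid_minor_rotation]). *)

(** * Euler's inequality from the cycle space *)

(** An invariant function is determined by arbitrary values on one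
    representative of each orbit. *)
Lemma card_invariant (D : finType) (f : D -> D) : injective f ->
  #|[set w : {ffun D -> bool} | [forall d, w (f d) == w d]]| = 2 ^ fcard f D.
Proof.
move=> injf; have fsym := fconnect_sym injf.
pose R := [set d in froots f].
have -> : fcard f D = #|R|.
  by apply: eq_card => d; rewrite !inE andbT.
rewrite -card_powerset.
pose A := fun w : {ffun D -> bool} => [set r in R | w r].
have wP (w : {ffun D -> bool}) : [forall d, w (f d) == w d] ->
    forall d, w d = (froot f d \in A w).
  move=> /forallP w_inv d; rewrite !inE roots_root //=.
  by apply: (@fconnect_invariant _ f _ w); [move=> x; apply: w_inv | exact: connect_root].
rewrite -(card_in_imset (f := A)); last first.
  move=> w1 w2; rewrite !inE => /wP w1P /wP w2P eqA.
  by apply/ffunP => d; rewrite w1P w2P eqA.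
apply: eq_card => B; apply/imsetP/idP => [[w _ ->]|].
  by rewrite inE; apply/fintype.subsetP => r; rewrite inE => /andP[].
rewrite inE => /fintype.subsetP sBR; exists [ffun d => froot f d \in B].
  rewrite inE; apply/forallP => d; rewrite !ffunE.
  by have /(fingraph.rootP fsym) <- := fconnect1 f d.
apply/setP => r; rewrite !inE ffunE.
apply/idP/andP => [rB|[/eqP-> //]].
have := sBR _ rB; rewrite inE => r_root; split=> //.
by rewrite (eqP r_root).
Qed.

Section CycleSpaceBound.

Variables (D V : finType) (org : D -> V) (rev phi : D -> D).

(** The cycles of the mod 2 cycle space: an edge set is encoded as a function on
    darts, and the sum runs over the darts that leave [v]. *)
Definition even_chain (C : D -> bool) :=
  forall v, \big[addb/false]_(d | org d == v) C d = false.

Hypothesis revK : involutive rev.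
Hypothesis rev_neq : forall d, rev d != d.
Hypothesis phi_inj : injective phi.
Hypothesis even_coboundary : forall C : {ffun D -> bool},
  (forall d, C (rev d) = C d) -> even_chain C ->
  exists w : {ffun D -> bool},
    (forall d, w (phi d) = w d) /\ forall d, w d (+) w (rev d) = C d.

Let chains : {set {ffun D -> bool}} :=
  [set C : {ffun D -> bool} | [forall d, C (rev d) == C d]].
Let bd (C : {ffun D -> bool}) : {set V} :=
  [set v | \big[addb/false]_(d | org d == v) C d].
Let cycles := [set C in chains | bd C == finset.set0].

(* Edge sets are the functions invariant under [rev], whose orbits are pairs. *)
Let card_chains : #|chains| ^ 2 = 2 ^ #|D|.
Proof.
rewrite card_invariant; last exact: inv_inj.
rewrite -expnM; congr (_ ^ _); apply: fcard_order_set; first exact: inv_inj.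
  apply/fintype.subsetP => d _; rewrite inE.
  apply/eqP/(@order_cycle _ _ [:: d; rev d]); last exact: mem_head.
    by rewrite /= revK !eqxx.
  by rewrite /= inE eq_sym rev_neq.
by [].
Qed.

Let cyclesP C : C \in cycles -> exists w : {ffun D -> bool},
    (forall d, w (phi d) = w d) /\ forall d, w d (+) w (rev d) = C d.
Proof.
rewrite !inE => /andP[/forallP C_rev /eqP bdC]; apply: even_coboundary.
  by move=> d; apply/eqP.
by move=> v; have := finset.in_set0 v; rewrite -bdC inE.
Qed.

(* Adding a constant to [w] does not change its coboundary, so that each cycle
   has two different preimages among the invariant functions. *)
Let card_cycles (d0 : D) : 2 * #|cycles| <= 2 ^ fcard phi D.
Proof.
have [w wP] : exists w : {ffun D -> bool} -> {ffun D -> bool}, forall C,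
   C \in cycles -> (forall d, w C (phi d) = w C d) /\
                   forall d, w C d (+) w C (rev d) = C d.
  have /fin_all_exists [w wP] : forall C, exists w : {ffun D -> bool},
     C \in cycles -> (forall d, w (phi d) = w d) /\
                   forall d, w d (+) w (rev d) = C d.
    move=> C; have [/cyclesP[w wP]|_] := boolP (C \in cycles); first by exists w.
    by exists [ffun=> true].
  by exists w.
rewrite -(card_invariant phi_inj) mulnC -card_bool -cardsT -cardsX.
pose g (Cb : {ffun D -> bool} * bool) : {ffun D -> bool} :=
  [ffun d => w Cb.1 d (+) Cb.2].
rewrite -(card_in_imset (f := g)).
  apply: subset_leq_card; apply/fintype.subsetP => _ /imsetP[[C b] + ->].
  rewrite finset.in_setX /= => /andP[/wP[wphi _] _]; rewrite inE.
  by apply/forallP => d; rewrite !ffunE /= wphi.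
move=> [C b] [C' b']; rewrite !finset.in_setX /= => /andP[/wP[_ wC] _] /andP[/wP[_ wC'] _].
move=> /ffunP eqg; have eqC : C = C'.
  apply/ffunP => d; rewrite -wC -wC'; move: (eqg d) (eqg (rev d)); rewrite !ffunE /=.
  by case: (w C d); case: (w C _); case: (w C' d); case: (w C' _);
    case: (b); case: (b').
move: (eqg d0); rewrite !ffunE /= eqC => /addbI <-.
by [].
Qed.

Let bdD (C C' : {ffun D -> bool}) v :
  (v \in bd [ffun d => C d (+) C' d]) = (v \in bd C) (+) (v \in bd C').
Proof.
by rewrite !inE -big_split /=; apply: eq_bigr => d _; rewrite ffunE.
Qed.

(* A nonempty fibre of the boundary map is a coset of the cycle space. *)
Let card_fiber B : #|[set C in chains | bd C == B]| <= #|cycles|.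
Proof.
set S := [set _ in _ | _]; have [->|[C0]] := set_0Vmem S; first by rewrite cards0.
rewrite !inE => /andP[/forallP C0rev /eqP bdC0].
pose g (C : {ffun D -> bool}) := [ffun d => C d (+) C0 d].
rewrite -(card_imset (mem S) (f := g)); last first.
  move=> C C' /ffunP eqg; apply/ffunP => d; have := eqg d.
  by rewrite !ffunE => /addIb.
apply: subset_leq_card; apply/fintype.subsetP => _ /imsetP[C + ->].
rewrite !inE => /andP[/forallP Crev /eqP bdC]; apply/andP; split.
  by apply/forallP => d; rewrite !ffunE (eqP (Crev d)) (eqP (C0rev d)).
by apply/eqP/setP => v; rewrite bdD bdC bdC0 addbb inE.
Qed.

(** Counting gives 2 ^ E <= 2 ^ V * #cycles, as boundaries are sets of vertices,
    and 2 * #cycles <= 2 ^ F; hence E + 1 <= V + F, doubled because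
    #|D| = 2 E. *)
Lemma euler_inequality : 0 < #|D| ->
  #|D| + 2 <= 2 * (#|[set org d | d in D]| + fcard phi D).
Proof.
move=> /card_gt0P[d0 _]; set V' := imset _ _.
have le_chains : #|chains| <= #|cycles| * 2 ^ #|V'|.
  rewrite -card_powerset.
  rewrite -sum1_card (partition_big bd (mem (powerset V'))) /=; last first.
    move=> C _; rewrite inE; apply/fintype.subsetP => v; rewrite inE => bdv.
    apply: contraT => vV'; move: bdv; rewrite big_pred0 // => d.
    by apply: contraNF vV' => /eqP <-; apply: imset_f.
  rewrite mulnC -sum_nat_const; apply: leq_sum => B _.
  rewrite sum1dep_card.
  by apply: leq_trans (card_fiber B); apply: subset_leq_card; apply/fintype.subsetP=> C; rewrite !inE.
have := card_cycles d0 => le_cycles.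
have : 2 * #|chains| <= 2 ^ (fcard phi D + #|V'|).
  by rewrite expnD; apply: leq_trans (leq_mul le_cycles (leqnn _)); rewrite -mulnA leq_mul2l.
rewrite -leq_sqr expnMn card_chains -expnD -expnM leq_exp2l // => le2.
lia.
Qed.

End CycleSpaceBound.

Local Open Scope ring_scope.

(** * Discharging: a rotation system without light edges has too few faces *)

Section InverseSums.

Variable F : numFieldType.

Lemma sum_inv_const (I : finType) (P : pred I) (n : nat) :
  #|P| = n -> (0 < n)%N -> \sum_(i | P i) (n%:R : F)^-1 = 1.
Proof.
move=> cardP n_gt0; rewrite sumr_const cardP -[LHS]mulr_natl mulfV //.
by rewrite pnatr_eq0 -lt0n.
Qed.

(** Each orbit receives total weight 1.  This is how the number of faces becomes a
    sum of contributions of single darts. *)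
Lemma sum_inv_order (D : finType) (f : D -> D) : injective f ->
  \sum_(d : D) ((order f d)%:R : F)^-1 = (fcard f D)%:R.
Proof.
move=> injf; have fsym := fconnect_sym injf.
rewrite (partition_big (froot f) (mem (froots f))) /=; last first.
  by move=> d _; exact: roots_root.
rewrite (eq_bigr (fun=> 1)) => [|r r_root]; last first.
  have rP d : (froot f d == r) = fconnect f r d.
    by rewrite -(root_connect fsym) (eqP r_root) eq_sym.
  under eq_bigl do rewrite rP.
  rewrite (eq_bigr (fun=> ((order f r)%:R : F)^-1)) => [|d rd]; last first.
    by congr (_%:R^-1); apply: eq_card => y; rewrite !inE (same_connect fsym rd).
  by apply: sum_inv_const; rewrite ?order_gt0.
rewrite sumr_const; congr (_ *+ _); apply: eq_card => r.
by rewrite !inE andbT.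
Qed.

Lemma sum_inv_fiber (D V : finType) (org : D -> V) :
  \sum_(d : D) ((#|[pred d' | org d' == org d]|)%:R : F)^-1
    = #|[set org d | d in D]|%:R.
Proof.
rewrite (partition_big org (mem [set org d | d in D])) /=; last first.
  by move=> d _; apply: imset_f.
rewrite (eq_bigr (fun=> 1)) => [|_ /imsetP[d0 _ ->]]; last first.
  rewrite (eq_bigr (fun=> ((#|[pred d' | org d' == org d0]|)%:R : F)^-1)); last first.
    by move=> d /eqP ->.
  by apply: sum_inv_const => //; apply/card_gt0P; exists d0; rewrite inE.
by rewrite sumr_const.
Qed.

End InverseSums.

Section Charges.

Variable F : realFieldType.

(** Give a dart that leaves a vertex of degree n into a face of length l the
    charge 6 / n - 3 + 6 / l; all charges add up to 6 (V - E + F).  Then [deficit n]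
    is the charge at a corner of a triangle with apex of degree n, when that is
    positive. *)
Definition deficit (n : nat) : F := if (n <= 5)%N then 6 / n%:R - 1 else 0.

(** The part of its deficit that a corner sends to each of its two neighbours on
    the face.  A triangle corner sends all of it; in a longer face, half of it is
    enough, and then no corner can receive too much. *)
Definition corner_share (l : nat) : F := if l == 3%N then 1/2 else 1/4.

Lemma deficit_ge6 n : (6 <= n)%N -> deficit n = 0.
Proof. by rewrite /deficit [(n <= 5)%N]leqNgt => ->. Qed.

Lemma deficit3 : deficit 3 = 1. Proof. by rewrite /deficit /=; lra. Qed.
Lemma deficit4 : deficit 4 = 1/2. Proof. by rewrite /deficit /=; lra. Qed.
Lemma deficit5 : deficit 5 = 1/5. Proof. by rewrite /deficit /=; lra. Qed.

Lemma inv_natr_le (m n : nat) : (0 < m <= n)%N -> (n%:R : F)^-1 <= m%:R^-1.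
Proof.
move=> /andP[m_gt0 le_mn].
by rewrite lef_pV2 ?posrE ?ltr0n ?ler_nat // (leq_trans m_gt0).
Qed.

Lemma deficit_bounds m n : (3 <= m <= 5)%N -> (m <= n)%N ->
  0 <= deficit n <= deficit m.
Proof.
move=> /andP[m3 m5] le_mn; rewrite [deficit m]/deficit m5.
have mV : 6%:R^-1 <= (m%:R : F)^-1.
  by apply: inv_natr_le; rewrite (leq_trans _ m3) // (leq_trans m5).
have [n6|n5] := leqP 6 n; first by rewrite deficit_ge6 //; lra.
have nV : 6%:R^-1 <= (n%:R : F)^-1.
  by apply: inv_natr_le; rewrite (leq_trans _ le_mn) ?(leq_trans _ m3) // ltnW.
have nmV : (n%:R : F)^-1 <= (m%:R : F)^-1.
  by apply: inv_natr_le; rewrite le_mn (leq_trans _ m3).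
by rewrite /deficit -ltnS n5; lra.
Qed.

Lemma charge_bound_small (n l : nat) : (3 <= n <= 5)%N -> (3 <= l)%N ->
  6 * n%:R^-1 - 3 + 6 * l%:R^-1 - 2 * (deficit n * corner_share l) <= 0.
Proof.
move=> /andP[n3 n5] l3; have dn : deficit n = 6 * n%:R^-1 - 1.
  by rewrite /deficit n5.
have nV : (n%:R : F)^-1 <= 3%:R^-1 by apply: inv_natr_le; rewrite n3.
rewrite dn /corner_share; case: eqP => [->|/eqP l_neq3]; first lra.
have lV : (l%:R : F)^-1 <= 4%:R^-1.
  by apply: inv_natr_le; rewrite /= ltn_neqAle eq_sym l_neq3 l3.
lra.
Qed.

Lemma charge_bound_long (n a b l : nat) :
  (6 <= n)%N -> (3 <= a)%N -> (3 <= b)%N -> (4 <= l)%N ->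
  6 * n%:R^-1 - 3 + 6 * l%:R^-1 + deficit a * corner_share l
    + deficit b * corner_share l <= 6 * n%:R^-1 - 1.
Proof.
move=> n6 a3 b3 l4; have kE : corner_share l = 1/4.
  by rewrite /corner_share; case: eqP l4 => // ->.
have lV : (l%:R : F)^-1 <= 4%:R^-1 by apply: inv_natr_le.
have /andP[_] := deficit_bounds (isT : 3 <= 3 <= 5)%N a3.
have /andP[_] := deficit_bounds (isT : 3 <= 3 <= 5)%N b3.
rewrite kE deficit3; lra.
Qed.

Lemma charge_bound_triangle (n a b : nat) : (6 <= n)%N ->
  (3 <= a)%N -> (3 <= b)%N -> (14 <= n + a)%N -> (14 <= n + b)%N ->
  (14 <= a + b)%N -> n != 11%N ->
  6 * n%:R^-1 - 1 + deficit a * (1/2) + deficit b * (1/2) <= 0.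
Proof.
wlog le_ab : a b / (a <= b)%N => [ihw|] n6 a3 b3 na nb ab n11.
  case/orP: (leq_total a b) => [le_ab|le_ba]; first exact: ihw.
  have : 6 * n%:R^-1 - 1 + deficit b * (1/2) + deficit a * (1/2) <= 0.
    by apply: ihw; rewrite // addnC.
  lra.
have b6 : (6 <= b)%N by clear -le_ab ab; lia.
rewrite (deficit_ge6 b6).
have [n12|n_lt12] := leqP 12 n.
  have nV : (n%:R : F)^-1 <= 12%:R^-1 by apply: inv_natr_le.
  have /andP[_] := deficit_bounds (isT : 3 <= 3 <= 5)%N a3.
  rewrite deficit3; lra.
have [n8|n_gt8] := leqP n 8.
  have a6 : (6 <= a)%N by clear -n8 na; lia.
  have nV : (n%:R : F)^-1 <= 6%:R^-1 by apply: inv_natr_le.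
  rewrite (deficit_ge6 a6); lra.
have {n11 n_lt12 n_gt8} [n10|n9] : n = 10%N \/ n = 9%N.
- by clear -n11 n_lt12 n_gt8; lia.
- have a4 : (4 <= a)%N by clear -n10 na; lia.
  have /andP[_] := deficit_bounds (isT : 3 <= 4 <= 5)%N a4.
  rewrite n10 deficit4; clear; lra.
- have a5 : (5 <= a)%N by clear -n9 na; lia.
  have /andP[_] := deficit_bounds (isT : 3 <= 5 <= 5)%N a5.
  rewrite n9 deficit5; clear; lra.
Qed.

(** [n] is the degree at a corner, [a] and [b] the degrees at the two neighbouring
    corners of a face of length [l]; [x] is the charge after redistribution.
    Heaviness of the edges makes it nonpositive, except for n = 11: a triangle in
    which one of the neighbours is small leaves an excess of at most
    6 / 11 - 1 + 1 / 2 = 1 / 22, while any other corner has charge at most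
    - 5 / 11 = - 10 / 22. *)
Lemma charge_bound (n a b l : nat) (x : F) :
  (3 <= n)%N -> (3 <= a)%N -> (3 <= b)%N -> (3 <= l)%N ->
  (14 <= n + a)%N -> (14 <= n + b)%N -> (l = 3 -> 14 <= a + b)%N ->
  x = 6 * n%:R^-1 - 3 + 6 * l%:R^-1 - 2 * (deficit n * corner_share l)
      + deficit a * corner_share l + deficit b * corner_share l ->
  [/\ n != 11%N -> x <= 0, n = 11%N -> x <= 1/22
    & n = 11%N -> ~~ ((l == 3%N) && ((a <= 5)%N (+) (b <= 5)%N)) ->
      x <= - (5/11)].
Proof.
move=> n3 a3 b3 l3 na nb ab xE.
have [n5|n6] := leqP n 5.
  have n11 : n <> 11%N by move=> n11; rewrite n11 in n5.
  have a6 : (6 <= a)%N by clear -n5 na; lia.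
  have b6 : (6 <= b)%N by clear -n5 nb; lia.
  have n35 : (3 <= n <= 5)%N by rewrite n3.
  split=> // _; have := charge_bound_small n35 l3.
  by rewrite xE (deficit_ge6 a6) (deficit_ge6 b6) !mul0r !addr0.
rewrite (deficit_ge6 n6) mul0r mulr0 subr0 in xE.
have [l_eq3|l4] := eqVneq l 3%N; last first.
  have {}l4 : (4 <= l)%N by rewrite ltn_neqAle eq_sym l4 l3.
  have := charge_bound_long n6 a3 b3 l4; rewrite -xE => xle.
  have nV : (n%:R : F)^-1 <= 6%:R^-1 by apply: inv_natr_le.
  split=> [_|n11|n11 _]; first lra; rewrite n11 in xle; lra.
have {}ab := ab l_eq3; rewrite l_eq3 /corner_share /= in xE.
have {}xE : x = 6 * n%:R^-1 - 1 + deficit a * (1/2) + deficit b * (1/2).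
  by rewrite xE; lra.
split=> [n11|n11|n11].
- by rewrite xE; apply: charge_bound_triangle.
- rewrite n11 in xE; have [a5|a6] := leqP a 5.
    have b6 : (6 <= b)%N by clear -a5 ab; lia.
    have /andP[_] := deficit_bounds (isT : 3 <= 3 <= 5)%N a3.
    rewrite xE (deficit_ge6 b6) deficit3; clear; lra.
  have /andP[_] := deficit_bounds (isT : 3 <= 3 <= 5)%N b3.
  rewrite xE (deficit_ge6 a6) deficit3; clear; lra.
- move=> both; have [a6 b6] : (6 <= a)%N /\ (6 <= b)%N.
    by clear -both ab; move: both ab; do 2!case: leqP => //=; lia.
  rewrite xE n11 (deficit_ge6 a6) (deficit_ge6 b6); clear; lra.
Qed.

End Charges.

Section Kotzig.

Variable F : realFieldType.

Variables (D V : finType) (org : D -> V) (rev sigma : D -> D).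
Let phi d := sigma (rev d).
Let phi' d := rev (finv sigma d).
Let deg v := #|[pred d | org d == v]|.

Hypothesis revK : involutive rev.
Hypothesis loopless : forall d, org (rev d) != org d.
Hypothesis simple : forall d d',
  org d = org d' -> org (rev d) = org (rev d') -> d = d'.
Hypothesis sigma_inj : injective sigma.
Hypothesis org_sigma : forall d, org (sigma d) = org d.
Hypothesis sigma_neq : forall d, sigma d != d.
Hypothesis deg_ge3 : forall d, (3 <= deg (org d))%N.
Hypothesis heavy : forall d, (14 <= deg (org d) + deg (org (rev d)))%N.

Let phiK' : cancel phi' phi.
Proof. by move=> d; rewrite /phi /phi' revK f_finv. Qed.

Let phi'K : cancel phi phi'.
Proof. by move=> d; rewrite /phi /phi' finv_f ?revK. Qed.

Let phi_inj : injective phi := can_inj phi'K.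

Let org_phi d : org (phi d) = org (rev d).
Proof. exact: org_sigma. Qed.

Let heavy_phi d : (14 <= deg (org d) + deg (org (phi d)))%N.
Proof. by rewrite org_phi. Qed.

(* A face of length 2 would go along an edge and straight back, so that [sigma]
   would fix a dart. *)
Let order_ge3 d : (3 <= order phi d)%N.
Proof.
have : iter (order phi d) phi d = d by apply: iter_order.
case: (order phi d) (order_gt0 phi d) => [|[|[|n]]] //= _.
  by move=> /(congr1 org)/eqP; rewrite org_phi (negbTE (loopless d)).
move=> phi2; have /eqP[] := sigma_neq (rev d).
apply: simple; first by rewrite org_sigma.
by rewrite revK -{2}phi2 org_phi.
Qed.

Let order_phi d : order phi (phi d) = order phi d.
Proof.
have fsym := fconnect_sym phi_inj.
by apply: eq_card => x; rewrite !inE -same_fconnect1.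
Qed.

Let order_phi' d : order phi (phi' d) = order phi d.
Proof. by rewrite -{2}[d]phiK' order_phi. Qed.

Let t d := deficit F (deg (org d)) * corner_share F (order phi d).
Let c d : F := 6 * (deg (org d))%:R^-1 - 3 + 6 * (order phi d)%:R^-1.
Let c' d := c d - 2 * t d + t (phi d) + t (phi' d).

Let sum_c' : \sum_d c' d = \sum_d c d.
Proof.
have E1 : \sum_d t (phi d) = \sum_d t d by rewrite [RHS](reindex_inj phi_inj).
have E2 : \sum_d t (phi' d) = \sum_d t d.
  by rewrite [RHS](reindex_inj (can_inj phiK')).
rewrite /c' 3!big_split /= E1 E2 sumrN -mulr_sumr; ring.
Qed.

Let sum_cE : \sum_d c d =
  6 * (#|[set org d | d in D]|%:R + (fcard phi D)%:R) - 3 * #|D|%:R.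
Proof.
have E3 : \sum_(d : D) - (3 : F) = - 3 * #|D|%:R by rewrite sumr_const mulr_natr.
rewrite /c 2!big_split /= E3 -!mulr_sumr sum_inv_order // sum_inv_fiber; ring.
Qed.

Let alternating d :=
  (order phi d == 3%N) && ((deg (org (phi d)) <= 5)%N (+) (deg (org (phi' d)) <= 5)%N).

Let dart_charge d :
  [/\ deg (org d) != 11%N -> c' d <= 0, deg (org d) = 11%N -> c' d <= 1/22
    & deg (org d) = 11%N -> ~~ alternating d -> c' d <= - (5/11)].
Proof.
apply: (@charge_bound F (deg (org d)) (deg (org (phi d))) (deg (org (phi' d)))
   (order phi d)) => //.
- by rewrite addnC -{2}[d]phiK' heavy_phi.
- move=> order3; suff <- : phi (phi d) = phi' d by apply: heavy_phi.
  apply: phi_inj; rewrite phiK'.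
  by have := iter_order phi_inj d; rewrite order3.
- by rewrite /c' /c /t order_phi order_phi'.
Qed.

(* Around a vertex of degree 11 one corner must fail to be [alternating], since
   small and large neighbours cannot alternate around an odd cycle.  Its charge
   pays for the other ten corners. *)
Let vertex_charge v : \sum_(d | org d == v) c' d <= 0.
Proof.
have [deg11|] := eqVneq (deg v) 11%N; last first.
  move=> deg11; apply: sumr_le0 => d /eqP dv.
  by have [+ _ _] := dart_charge d; apply; rewrite dv.
have [/existsP[d0 /andP[/eqP d0v d0N]]|all_alt] :=
  boolP [exists d, (org d == v) && ~~ alternating d].
  rewrite (bigD1 d0) ?d0v //=.
  have [_ _ /(_ _ d0N)] := dart_charge d0; rewrite d0v => /(_ deg11) c0.
  have : \sum_(d | (org d == v) && (d != d0)) c' d <=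
         \sum_(d | (org d == v) && (d != d0)) 1/22.
    apply: ler_sum => d /andP[/eqP dv _].
    by have [_ + _] := dart_charge d; apply; rewrite dv.
  rewrite sumr_const; have -> : #|[pred d | (org d == v) & (d != d0)]| = 10%N.
    have := cardD1 d0 [pred d | org d == v].
    rewrite inE d0v eqxx -[#|_|]/(deg v) deg11 add1n => -[] ->.
    by apply: eq_card => d; rewrite !inE andbC.
  lra.
pose small d := (deg (org (rev d)) <= 5)%N.
have smallN d : org d = v -> small (sigma d) = ~~ small d.
  move=> dv; have : alternating (sigma d).
    apply: contraNT all_alt => altN; apply/existsP; exists (sigma d).
    by rewrite org_sigma dv eqxx.
  rewrite /alternating /phi' finv_f // => /andP[_].
  by rewrite org_phi -/(small _) -/(small _) addbC; case: (small d); case: (small _).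
pose A := [set d | (org d == v) && small d].
pose B := [set d | (org d == v) && ~~ small d].
have AB : #|A| = #|B|.
  rewrite -(card_imset (mem A) sigma_inj); apply: eq_card => d.
  apply/imsetP/idP => [[d' + ->]|]; rewrite !inE.
    by move=> /andP[/eqP d'v sd']; rewrite org_sigma d'v eqxx smallN ?sd'.
  have dE := f_finv sigma_inj d; set d' := finv _ _ in dE.
  rewrite -dE org_sigma => /andP[d'v]; rewrite smallN ?(eqP d'v) // negbK => sd'.
  by exists d'; rewrite // inE d'v.
have : deg v = (#|A| + #|B|)%N.
  rewrite /deg -(cardID (mem small) [pred d | org d == v]) !cardsE.
  by congr (_ + _)%N; apply: eq_card => d; rewrite !inE andbC.
by rewrite deg11 -AB addnn => /(congr1 odd); rewrite odd_double.
Qed.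

(** The discharging half of Kotzig's theorem, as V + F <= E (doubled): it contradicts
    [euler_inequality].  [sigma] may permute the darts at one vertex in several
    cycles, as long as it has no fixed point. *)
Lemma heavy_edges_few_faces :
  (2 * (#|[set org d | d in D]| + fcard phi D) <= #|D|)%N.
Proof.
have : \sum_d c d <= 0.
  rewrite -sum_c' (partition_big org predT) //=.
  by apply: sumr_le0 => v _; exact: vertex_charge.
rewrite sum_cE -natrD -!natrM -(ler_nat F) natrM subr_le0 !natrM; lra.
Qed.

End Kotzig.

(** * The square grid on a torus *)

Section Grid.

Variable n : nat.

(** Coordinates are taken modulo n + 2 to make reversal total.  Planarity comes back
    by keeping away from the row and the column of coordinate -1. *)
Definition grid_point : finType := ('I_n.+2 * 'I_n.+2)%type.
(** A direction is a pair: the axis (false for horizontal, true for vertical) and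
    the sign (true for negative). *)
Definition dart : finType := (grid_point * (bool * bool))%type.

Definition step (p : grid_point) (b : bool * bool) : grid_point :=
  let s : 'I_n.+2 := if b.2 then -1 else 1 in
  if b.1 then (p.1, p.2 + s) else (p.1 + s, p.2).

Definition drev (d : dart) : dart := (step d.1 d.2, (d.2.1, ~~ d.2.2)).
(** Quarter turn counterclockwise. *)
Definition drot (d : dart) : dart := (d.1, (~~ d.2.1, d.2.2 (+) d.2.1)).

Definition off_seam (p : grid_point) := (p.1 != -1) && (p.2 != -1).

Lemma drevK : involutive drev.
Proof.
by case=> [[x y] [[] []]]; rewrite /drev /step /= ?addrNK ?addrK ?subrK.
Qed.

Lemma drev_neq d : drev d != d.
Proof. by apply/eqP => /(congr1 (fun e => e.2.2)) /=; case: d.2.2. Qed.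

Lemma drot_inj : injective drot.
Proof. by case=> [p [[] []]] [q [[] []]] // [->]. Qed.

Lemma big_star (F : dart -> bool) p : \big[addb/false]_(d | d.1 == p) F d =
  F (p, (false, false)) (+) F (p, (true, false)) (+) F (p, (false, true))
    (+) F (p, (true, true)).
Proof.
rewrite (reindex_onto (fun b => (p, b)) snd) /=; last by case=> q b /= /eqP ->.
rewrite (eq_bigl xpredT) => [|b]; last by rewrite !eqxx.
have -> : \big[addb/false]_(b : bool * bool) F (p, b) =
    \big[addb/false]_(b1 : bool) \big[addb/false]_(b2 : bool) F (p, (b1, b2)).
  by rewrite pair_bigA; apply: eq_bigr => -[].
rewrite !big_bool.
by case: (F _); case: (F _); case: (F _); case: (F _).
Qed.

(** The unit cell to the right of a dart, named by its lower left corner. *)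
Definition rcell (d : dart) : grid_point :=
  let: (x, y) := d.1 in
  match d.2 with
  | (false, false) => (x, y - 1)
  | (true, false) => (x, y)
  | (false, true) => (x - 1, y)
  | (true, true) => (x - 1, y - 1)
  end.

(** Going to the head of a dart and turning right keeps the cell on the right. *)
Lemma rcell_drot_drev d : rcell (drot (drev d)) = rcell d.
Proof. by case: d => [[x y] [[] []]]; rewrite /rcell /= ?addrK. Qed.

Lemma ord_add1 (i : nat) : (i.+1 < n.+2)%N -> inord i.+1 = inord i + 1 :> 'I_n.+2.
Proof.
move=> lt_i; apply: val_inj; rewrite /= !inordK ?(ltnW lt_i) //.
by rewrite modn_small // addn1.
Qed.

Lemma ord_N1 : inord n.+1 = -1 :> 'I_n.+2.
Proof.
by apply/eqP; rewrite -addr_eq0; apply/eqP/val_inj; rewrite /= inordK // addn1 modnn.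
Qed.

Lemma ord_0 : inord 0 = 0 :> 'I_n.+2.
Proof. by apply: val_inj; rewrite /= inordK. Qed.

Section Coboundary.

Variable C : dart -> bool.
Hypothesis C_rev : forall d, C (drev d) = C d.
Hypothesis C_even : even_chain fst C.
Hypothesis C_seam : forall d, C d -> off_seam d.1.

Let C_star p : C (p, (false, false)) (+) C (p, (true, false))
  (+) C (p, (false, true)) (+) C (p, (true, true)) = false.
Proof. by rewrite -big_star C_even. Qed.

(* The parity of the edges met by a horizontal ray that goes left from a cell of
   row [y]. *)
Let w (i : nat) (y : 'I_n.+2) :=
  \big[addb/false]_(k < i.+1) C ((inord k, y), (true, false)).

(* Telescoping: evenness at each point of a row exchanges the two vertical edges
   for the two horizontal ones. *)
Let w_vert i y : (i < n.+2)%N ->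
  w i y (+) w i (y - 1) = C ((inord i, y), (false, false)).
Proof.
have star x : C ((x, y), (true, false)) (+) C ((x, y - 1), (true, false)) =
    C ((x, y), (false, false)) (+) C ((x - 1, y), (false, false)).
  rewrite -(C_rev ((x, y - 1), _)) -(C_rev ((x - 1, y), _)) /drev /step /= !subrK.
  have := C_star (x, y).
  by case: (C _); case: (C _); case: (C _); case: (C _).
elim: i => [|i IHi] lt_i.
  rewrite /w !big_ord1 star ord_0 sub0r.
  have : ~~ C ((-1, y), (false, false)).
    by apply/negP => /C_seam; rewrite /off_seam eqxx.
  by move=> /negbTE ->; rewrite addbF.
rewrite /w big_ord_recr [X in _ (+) X]big_ord_recr /= -/(w _ _) -/(w _ _).
rewrite addbACA IHi ?(ltnW lt_i) // star (ord_add1 lt_i) addrK.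
by rewrite [_ (+) C ((inord i, y), _)]addbC addKb.
Qed.

(* The rays that go all the way around the torus see an even number of edges: by
   [w_vert] all rows have the same parity, and the row at the seam is empty. *)
Let w_row y : w n.+1 y = false.
Proof.
have rowN1 : w n.+1 (-1) = false.
  rewrite /w big1 // => k _; apply: contraTF isT => /C_seam.
  by rewrite /off_seam eqxx andbF.
have row_step z : w n.+1 z = w n.+1 (z - 1).
  have C0 : C ((-1, z), (false, false)) = false.
    by apply/negP => /C_seam; rewrite /off_seam eqxx.
  have := w_vert z (ltnSn n.+1); rewrite ord_N1 C0.
  by case: (w _ _); case: (w _ _).
have row_nat i : w n.+1 i%:R = false.
  elim: i => [|i IHi]; first by rewrite row_step mulr0n sub0r.
  by rewrite row_step mulrS [1 + _]addrC addrK.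
by rewrite -[y]natr_Zp row_nat.
Qed.

Let W (c : grid_point) := w c.1 c.2.

(** The substitute for the Jordan curve theorem: an even edge set that avoids the
    seam separates the cells into two sides. *)
Lemma grid_coboundary : exists W : grid_point -> bool,
  forall d, W (rcell (drot d)) (+) W (rcell d) = C d.
Proof.
have horiz (x y : 'I_n.+2) : w x y (+) w (x - 1 : 'I_n.+2)%R y = C ((x, y), (true, false)).
  have [lt_x|] := ltnP x n.+2; last by rewrite leqNgt ltn_ord.
  rewrite -[x]inord_val; case: (val x) lt_x => [|i] lt_i.
    rewrite [in X in _ (+) X]ord_0 sub0r -ord_N1 !inordK // w_row addbF.
    by rewrite /w big_ord1.
  rewrite [in X in _ (+) X]ord_add1 // addrK !inordK ?(ltnW lt_i) //.
  by rewrite /w big_ord_recr /= addbC addKb.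
have vert (x y : 'I_n.+2) : w x y (+) w x (y - 1) = C ((x, y), (false, false)).
  by rewrite w_vert // inord_val.
exists W; case=> [[x y] [[] []]]; rewrite /rcell /W /=.
- rewrite addbC -[RHS]C_rev /drev /step /= -horiz addbC.
  done.
- by rewrite addbC horiz.
- by rewrite -[RHS]C_rev /drev /step /= -vert addbC.
- by rewrite vert.
Qed.

End Coboundary.

End Grid.

(** * First-return maps and spanning forests *)

Section FirstReturn.

Variables (T : finType) (f : T -> T) (S : pred T).
Hypothesis f_inj : injective f.

(** [f x] is the default value of [nth] because the orbit is a trajectory that
    starts there; the default is reached only if the orbit avoids [S]. *)
Definition first_return x := nth (f x) (orbit f (f x)) (find S (orbit f (f x))).

Lemma first_returnP x : S x -> exists k, [/\ first_return x = iter k.+1 f x,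
  S (iter k.+1 f x) & forall j, (j < k)%N -> ~~ S (iter j.+1 f x)].
Proof.
move=> Sx; set s := orbit f (f x).
have has_s : has S s.
  apply/hasP; exists x => //; rewrite -fconnect_orbit.
  by rewrite (fconnect_sym f_inj) fconnect1.
have nth_s i : (i < size s)%N -> nth (f x) s i = iter i.+1 f x.
  by rewrite size_orbit => lt_i; rewrite /s /orbit nth_traject // iterSr.
have := has_s; rewrite has_find => lt_find; exists (find S s).
rewrite -nth_s //; split=> // [|j lt_j]; first exact: nth_find.
by rewrite -nth_s ?before_find // (ltn_trans lt_j).
Qed.

Lemma first_return_inj x y : S x -> S y ->
  first_return x = first_return y -> x = y.
Proof.
wlog suff: x y / forall k l, (k <= l)%N -> S x ->
    (forall j, (j < l)%N -> ~~ S (iter j.+1 f y)) ->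
    iter k.+1 f x = iter l.+1 f y -> x = y.
  move=> ihw Sx Sy; have [k [-> _ kN]] := first_returnP Sx.
  have [l [-> _ lN]] := first_returnP Sy.
  have [le_kl|/ltnW le_lk] := leqP k l; first exact: ihw le_kl Sx lN.
  by move=> /esym eqf; apply/esym; apply: ihw le_lk Sy kN eqf.
move=> k l le_kl Sx lN; rewrite -(subnKC le_kl) -addSn iterD.
have iter_inj m : injective (iter m f).
  by elim: m => //= m IHm; apply: inj_comp.
move=> /iter_inj; case E: (l - k)%N => [|j] //= xE.
have /lN : (j < l)%N by lia.
by rewrite iterS -xE Sx.
Qed.

Lemma first_return_fix x y : S x -> S y ->
  first_return x = x -> fconnect f x y -> y = x.
Proof.
move=> Sx Sy; have [k [-> _ kN]] := first_returnP Sx => fix_x xy.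
have le_order : (order f x <= k.+1)%N.
  rewrite leqNgt; apply/negP => /findex_iter.
  by rewrite fix_x findex0.
have := leq_trans (findex_max xy) le_order; have yE := iter_findex xy.
case: (findex f x y) yE => [<- //|m] yE /kN.
by rewrite yE Sy.
Qed.

End FirstReturn.

Lemma connect_eq (T : finType) (K : Type) (e : rel T) (k : T -> K) :
  (forall x y, e x y -> k x = k y) -> forall x y, connect e x y -> k x = k y.
Proof.
move=> ek x y /connectP[s es ->]; elim: s x es => //= z s IHs x /andP[xz].
by move=> /IHs <-; apply: ek.
Qed.

(** The distance to the root of the component strictly decreases along some edge,
    which gives parent pointers. *)
Lemma spanning_forest (T : finType) (e : rel T) : connect_sym e ->
  exists depth : T -> nat, forall p, p != fingraph.root e p ->
    exists2 q, e p q & (depth q < depth p)%N.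
Proof.
move=> e_sym.
pose reach p m := [exists t : m.-tuple T,
  path e p t && (last p t == fingraph.root e p)].
have ex_reach p : exists m, reach p m.
  have /connectP[s es sE] := connect_root e p.
  by exists (size s); apply/existsP; exists (in_tuple s); rewrite es sE /=.
exists (fun p => ex_minn (ex_reach p)) => p p_root.
case: ex_minnP => m /existsP[[s size_s] /= /andP[ps /eqP sE] min_m].
case: s size_s ps sE => [|q s] size_s /=; first by move=> _ pE; rewrite -pE eqxx in p_root.
move=> /andP[pq qs] sE; exists q => //.
have qE : fingraph.root e q = fingraph.root e p.
  by apply/esym/eqP; rewrite (root_connect e_sym) connect1.
case: ex_minnP => m' _ min_m'; rewrite -(eqP size_s) ltnS; apply: min_m'.
by apply/existsP; exists (in_tuple s); rewrite qs qE sE /=.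
Qed.

(** * The rotation system of a minor of the grid *)

Definition grid_adj (n : nat) (p q : grid_point n) := [exists b, q == step p b].

Lemma grid_adj_sym n : symmetric (@grid_adj n).
Proof.
suff imp (p q : grid_point n) : grid_adj p q -> grid_adj q p.
  by move=> p q; apply/idP/idP; apply: imp.
move=> /existsP[b /eqP->]; apply/existsP; exists (b.1, ~~ b.2).
by have [/esym/eqP] := drevK (p, b).
Qed.

Definition blob_adj (n : nat) (V : finType) (lab : grid_point n -> option V) :=
  [rel p q : grid_point n |
    [&& lab p != None, lab q == lab p & grid_adj p q]].

Lemma blob_adj_sym (n : nat) (V : finType) (lab : grid_point n -> option V) :
  connect_sym (blob_adj lab).
Proof.
apply: sym_connect_sym => p q /=; rewrite grid_adj_sym [lab q == lab p]eq_sym.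
by case: (lab p =P lab q) => [->|_]; rewrite ?eqxx ?andbF.
Qed.

(** [lab] sends a grid point to the vertex whose blob contains it. *)
Definition grid_minor (n : nat) (V : finType) (h : rel V)
    (lab : grid_point n -> option V) : Prop :=
  [/\ forall p, lab p != None -> off_seam p,
      forall p q, lab p != None -> lab p = lab q -> connect (blob_adj lab) p q
    & forall u v, h u v -> exists p b, lab p = Some u /\ lab (step p b) = Some v].

Definition arc (V : finType) (h : rel V) : finType := {x : V * V | h x.1 x.2}.

Definition arc_org (V : finType) (h : rel V) (x : arc h) : V := (val x).1.

Definition arc_rev (V : finType) (h : rel V) (h_sym : symmetric h) (x : arc h) :
  arc h := Sub ((val x).2, (val x).1) (etrans (h_sym _ _) (valP x)).

(** The third condition says that an orbit of length 1 occurs only at a vertex of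
    degree 1.  The last one is the hypothesis of [euler_inequality]. *)
Definition planar_rotation (V : finType) (h : rel V) (h_sym : symmetric h)
    (sigma : arc h -> arc h) : Prop :=
  [/\ injective sigma, forall x, arc_org (sigma x) = arc_org x,
      forall x y, sigma x = x -> arc_org y = arc_org x -> y = x
    & forall C : {ffun arc h -> bool},
        (forall x, C (arc_rev h_sym x) = C x) -> even_chain (@arc_org V h) C ->
        exists w : {ffun arc h -> bool},
          (forall x, w (sigma (arc_rev h_sym x)) = w x) /\
          forall x, w x (+) w (arc_rev h_sym x) = C x].

Section GridMinor.

Variables (n : nat) (V : finType) (h : rel V) (lab : grid_point n -> option V).
Hypothesis h_sym : symmetric h.
Hypothesis h_irr : irreflexive h.
Hypothesis lab_minor : grid_minor h lab.

Notation root := (fingraph.root (blob_adj lab)).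
Notation dart := (dart n).
Notation drev := (@drev n).
Notation drot := (@drot n).

Let lab_seam p : lab p != None -> off_seam p. Proof. by case: lab_minor => + _ _; apply. Qed.
Let lab_conn p q :
  lab p != None -> lab p = lab q -> connect (blob_adj lab) p q.
Proof. by case: lab_minor => _ + _; apply. Qed.

Let adj_sym : connect_sym (blob_adj lab) := blob_adj_sym lab.

Let lab_connect p q : connect (blob_adj lab) p q -> lab p = lab q.
Proof. by apply: connect_eq => x y /= /and3P[_ /eqP]. Qed.

Let root_lab p : lab (root p) = lab p.
Proof. by apply/esym/lab_connect/connect_root. Qed.

Let root_eq p q : lab p != None -> lab p = lab q -> root p = root q.
Proof. by move=> p_lab pq; apply/(fingraph.rootP adj_sym)/lab_conn. Qed.

Let forest_data : exists (depth : grid_point n -> nat) (par : grid_point n -> dart),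
  forall p, p != root p -> [/\ (par p).1 = p,
     lab p != None, lab (drev (par p)).1 = lab p
     & (depth (drev (par p)).1 < depth p)%N].
Proof.
have [depth depthP] := spanning_forest adj_sym.
exists depth; suff /fin_all_exists[par parP] : forall p, exists d : dart,
    p != root p -> [/\ d.1 = p, lab p != None, lab (drev d).1 = lab p
    & (depth (drev d).1 < depth p)%N] by exists par.
move=> p; have [pE|p_root] := eqVneq p (root p).
  by exists (p, (false, false)).
have [q /and3P[p_lab /eqP qp /existsP[b /eqP qE]] lt_qp] := depthP p p_root.
by exists (p, b); rewrite /= -qE; split.
Qed.

Section Forest.

Variables (depth : grid_point n -> nat) (par : grid_point n -> dart).
Hypothesis parP : forall p, p != root p -> [/\ (par p).1 = p,
     lab p != None, lab (drev (par p)).1 = lab p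
     & (depth (drev (par p)).1 < depth p)%N].

Let up (d : dart) := (d.1 != root d.1) && (d == par d.1).
Let tree (d : dart) := up d || up (drev d).

Let tree_rev d : tree (drev d) = tree d.
Proof. by rewrite /tree drevK orbC. Qed.

Let tree_lab d : tree d -> lab d.1 != None /\ lab (drev d).1 = lab d.1.
Proof.
case/orP => /andP[/parP[_ lab_d revd _] /eqP dE].
  by split=> //; rewrite [in LHS]dE.
by rewrite -dE drevK in revd; rewrite revd.
Qed.

(* At a point of maximal depth among those met by the chain, the only edge of the
   chain is the one to the parent, an odd number. *)
Let acyclic (b : dart -> bool) : (forall d, b (drev d) = b d) ->
  (forall d, b d -> tree d) -> even_chain fst b -> forall d, b d = false.
Proof.
move=> b_rev b_tree b_even d1; apply/negP => bd1.
pose d0 := [arg max_(d > d1 | b d) depth d.1].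
have [bd0 max_d0] : b d0 /\ forall d, b d -> (depth d.1 <= depth d0.1)%N.
  by rewrite /d0; case: arg_maxnP => // d bd max_d; split.
have up_d0 d : b d -> d.1 = d0.1 -> d = par d0.1.
  move=> bd d1E; rewrite -d1E; have := b_tree d bd.
  case/orP => /andP[]; first by move=> _ /eqP.
  move=> /parP[_ _ _ lt_d] /eqP dE; rewrite -dE drevK d1E in lt_d.
  by have := max_d0 (drev d); rewrite b_rev leqNgt lt_d => /(_ bd).
have := b_even d0.1; rewrite (bigD1 d0) //= bd0 big1 // => d /andP[/eqP d1E neq_d].
by apply: contraNF neq_d => bd; rewrite (up_d0 d) // [d0 in eqbRHS]up_d0.
Qed.

Let tree_const (w : dart -> bool) : (forall d, w (drot d) = w d) ->
  (forall d, tree d -> w (drev d) = w d) ->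
  forall d d', lab d.1 != None -> lab d.1 = lab d'.1 -> w d = w d'.
Proof.
move=> w_rot w_rev.
have w_star p b b' : w (p, b) = w (p, b').
  suff {b b'} E b : w (p, (false, false)) = w (p, b) by rewrite -E.
  have E d : w (drot d) = w d by [].
  have := (E (p, (false, false)), E (p, (true, false)), E (p, (false, true))).
  move=> /= [[E1 E2] E3].
  by case: b => [[] []]; rewrite ?E3 ?E2 ?E1.
have w_root p b : w (p, b) = w (root p, b).
  have [m] := ubnP (depth p); elim: m p b => // m IHm p b lt_p.
  have [<- //|p_root] := eqVneq p (root p).
  have [par1 p_lab lab_par lt_par] := parP p_root.
  have tree_par : tree (par p) by rewrite /tree /up par1 p_root eqxx.
  have := IHm (drev (par p)).1 b; rewrite (leq_trans lt_par) // => /(_ isT).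
  rewrite (@root_eq (drev (par p)).1 p) ?lab_par // => <-.
  rewrite (w_star p b (par p).2) -{1}par1 -surjective_pairing -w_rev //.
  by rewrite [drev _]surjective_pairing; apply: w_star.
move=> [p b] [q b'] /= p_lab pq; rewrite w_root [RHS]w_root (root_eq p_lab pq).
exact: w_star.
Qed.

Let star_pred1 (d : dart) p :
  \big[addb/false]_(d' | d'.1 == p) (d' == d) = (p == d.1).
Proof.
have [->|neq_p] := eqVneq p d.1.
  by rewrite (bigD1 d) //= eqxx big1 // => d' /andP[_ /negbTE].
rewrite big1 // => d' /eqP d'p; apply/negP => /eqP d'd.
by rewrite -d'p d'd eqxx in neq_p.
Qed.

(* The path in the forest from [p] to its root: its boundary is these two ends. *)
Let tree_path p : exists c : dart -> bool, [/\ forall d, c (drev d) = c d,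
  forall d, c d -> tree d
  & forall x, \big[addb/false]_(d | d.1 == x) c d = (x == p) (+) (x == root p)].
Proof.
have [m] := ubnP (depth p); elim: m p => // m IHm p lt_p.
have [<-|p_root] := eqVneq p (root p).
  by exists (fun=> false); split=> // x; rewrite big1 // addbb.
have [par1 p_lab lab_par lt_par] := parP p_root.
have tree_par : tree (par p) by rewrite /tree /up par1 p_root eqxx.
have [|c [c_rev c_tree c_bd]] := IHm (drev (par p)).1.
  exact: leq_trans lt_par lt_p.
exists (fun d => c d (+) ((d == par p) (+) (d == drev (par p)))); split.
- move=> d; rewrite c_rev; congr (_ (+) _).
  by rewrite (inv_eq (@drevK n)) (can_eq (@drevK n)) addbC.
- move=> d; case: (c d) (c_tree d) => [-> //|_] /=.
  by case: eqP => [-> //|_] /=; case: eqP => [-> _|//]; rewrite tree_rev.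
- move=> x; rewrite !big_split /= c_bd !star_pred1 par1.
  rewrite (@root_eq (drev (par p)).1 p) ?lab_par //.
  by case: (x == _); case: (x == _); case: (x == _).
Qed.

(** [iota] chooses one grid edge for each edge of the graph; as a rotation system
    for the graph is sought, everything inside a blob has to be contracted. *)
Section Rotation.

Variable iota : V -> V -> dart.
Hypothesis iotaP : forall u v, h u v -> [/\ lab (iota u v).1 = Some u,
  lab (drev (iota u v)).1 = Some v & iota v u = drev (iota u v)].

Let link (x : arc h) : dart := iota (val x).1 (val x).2.

Let link_lab x : lab (link x).1 = Some (arc_org x).
Proof. by have [] := iotaP (valP x). Qed.

Let link_rev x : link (arc_rev h_sym x) = drev (link x).
Proof. by have [] := iotaP (valP x). Qed.

Let link_inj : injective link.
Proof.
move=> x y eq_xy; apply: val_inj.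
have := link_lab x; have := link_lab (arc_rev h_sym x).
rewrite !link_rev eq_xy -!link_rev !link_lab => -[e2] [e1].
by rewrite [val x]surjective_pairing [val y]surjective_pairing; congr (_, _).
Qed.

Let S (d : dart) := [exists x, link x == d].

Let S_link x : S (link x).
Proof. by apply/existsP; exists x. Qed.

Let S_rev d : S d -> S (drev d).
Proof. by move=> /existsP[x /eqP<-]; rewrite -link_rev. Qed.

Let S_tree d : S d -> tree d = false.
Proof.
move=> /existsP[x /eqP<-]; apply/negP => /tree_lab[_].
rewrite -link_rev !link_lab => -[x_loop].
by have := valP x; rewrite /= -[(val x).1]/(arc_org x) -x_loop h_irr.
Qed.

(* One step of the walk around the trees of the forest: turn, after crossing the
   edge if it is in the forest. *)
Let psi d := drot (if tree d then drev d else d).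

Let psi_inj : injective psi.
Proof.
move=> d d' /(@drot_inj n).
have [td|td] := boolP (tree d); have [td'|td'] := boolP (tree d') => // eqd.
- exact: (can_inj (@drevK n)).
- by rewrite -eqd tree_rev td in td'.
- by rewrite eqd tree_rev td' in td.
Qed.

(* The walk around a tree visits everything.  For an invariant function [w], let
   [b] be the set of forest edges whose two darts have different values.  Then [b d]
   is the change of [w] from [d] to [drot d], so that [b] is even at each point; by
   acyclicity it is empty. *)
Let psi_const (w : dart -> bool) : (forall d, w (psi d) = w d) ->
  forall d d', lab d.1 != None -> lab d.1 = lab d'.1 -> w d = w d'.
Proof.
move=> w_psi; pose b d := tree d && (w d (+) w (drev d)).
have w_rot d : w (drot d) = w d (+) b d.
  rewrite /b; have [td|td] := boolP (tree d); last first.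
    by rewrite addbF -[RHS]w_psi /psi (negbTE td).
  by rewrite addKb -[in RHS]w_psi /psi tree_rev td drevK.
have b0 : forall d, b d = false.
  apply: acyclic => [d|d /andP[]//|p].
    by rewrite /b tree_rev drevK addbC.
  rewrite (eq_bigr (fun d => w d (+) w (drot d))) => [|d _]; last first.
    by rewrite w_rot addKb.
  rewrite big_star /drot /=.
  by case: (w _); case: (w _); case: (w _); case: (w _).
apply: tree_const => [d|d td]; first by rewrite w_rot b0 addbF.
by have := b0 d; rewrite /b td; case: (w d); case: (w _).
Qed.

(* The next chosen edge met by the walk. *)
Let sigma (x : arc h) : arc h :=
  odflt x [pick y | link y == first_return psi S (link x)].

Let link_sigma x : link (sigma x) = first_return psi S (link x).
Proof.
have [k [E /existsP[y /eqP yE] _]] := first_returnP psi_inj (S_link x).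
rewrite /sigma; case: pickP => [z /eqP //|/(_ y)].
by rewrite yE E eqxx.
Qed.

Let sigma_inj : injective sigma.
Proof.
move=> x y /(congr1 link); rewrite (link_sigma x) (link_sigma y) => eq_xy.
exact/link_inj/(first_return_inj psi_inj (S_link x) (S_link y)).
Qed.

Let org_sigma x : arc_org (sigma x) = arc_org x.
Proof.
suff : lab (link (sigma x)).1 = lab (link x).1 by rewrite !link_lab => -[].
rewrite link_sigma.
have [k [-> _ _]] := first_returnP psi_inj (S_link x).
elim: k.+1 => //= m <-; rewrite /psi /=.
by case: ifP => // /tree_lab[].
Qed.

Let sigma_fix x y : sigma x = x -> arc_org y = arc_org x -> y = x.
Proof.
move=> fix_x xy; apply: link_inj.
apply: (first_return_fix psi_inj (S_link x) (S_link y)).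
  by rewrite -link_sigma fix_x.
have E : fconnect psi (link x) (link x) = fconnect psi (link x) (link y).
  apply: psi_const; rewrite ?link_lab ?xy // => d.
  by apply/esym/same_fconnect1_r.
by rewrite -E connect0.
Qed.

Let addb_big_pred1 (I : finType) (P : pred I) (F : I -> bool) i0 :
  (forall i, P i -> i != i0 -> F i = false) ->
  \big[addb/false]_(i | P i) F i = P i0 && F i0.
Proof.
move=> F0; have [Pi0|nPi0] := boolP (P i0).
  by rewrite (bigD1 i0) //= big1 ?addbF // => i /andP[]; apply: F0.
rewrite big1 // => i Pi; apply: F0 => //.
by apply: contraNneq nPi0 => <-.
Qed.

(* Put the chosen grid edges of [C] together with the forest paths from their ends
   to the roots.  All points become even: the roots too, as [C] is even at each
   vertex. *)
Let lift_chain (C : arc h -> bool) :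
  (forall x, C (arc_rev h_sym x) = C x) -> even_chain (@arc_org V h) C ->
  exists C' : dart -> bool, [/\ forall d, C' (drev d) = C' d,
    even_chain fst C', forall d, C' d -> S d || tree d
    & forall x, C' (link x) = C x].
Proof.
move=> C_rev C_even.
pose Cs d := \big[addb/false]_(x | link x == d) C x.
have Cs_link x : Cs (link x) = C x.
  rewrite /Cs (addb_big_pred1 (i0 := x)) ?eqxx // => y /eqP/link_inj->.
  by rewrite eqxx.
have Cs_S d : ~~ S d -> Cs d = false.
  move=> nSd; rewrite /Cs big_pred0 // => x.
  by apply: contraNF nSd => /eqP <-.
have Cs_rev d : Cs (drev d) = Cs d.
  have [/existsP[x /eqP<-]|nSd] := boolP (S d).
    by rewrite -link_rev !Cs_link.
  rewrite !Cs_S //; apply: contra nSd => /S_rev.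
  by rewrite drevK.
pose s p := \big[addb/false]_(d | d.1 == p) Cs d.
have s_lab p : lab p == None -> s p = false.
  move=> p_lab; rewrite /s big1 // => d /eqP dp; apply: Cs_S.
  apply/existsP => -[x /eqP xd]; have := link_lab x.
  by rewrite xd dp (eqP p_lab).
have s_blob v : \big[addb/false]_(p | lab p == Some v) s p = false.
  rewrite -[RHS](C_even v) [RHS](partition_big link (fun d => lab d.1 == Some v)) /=.
    apply/esym; rewrite (partition_big fst (fun p => lab p == Some v)) //=.
    apply: eq_bigr => p /eqP p_v; apply: eq_big => d.
      by have [->|_] := eqVneq d.1 p; rewrite ?p_v ?eqxx ?andbF.
    move=> /andP[_ /eqP dp]; apply: eq_bigl => x.
    have [xd|_] := eqVneq (link x) d; rewrite ?andbF // andbT.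
    by have := link_lab x; rewrite xd dp p_v => -[->]; rewrite eqxx.
  by move=> x /eqP <-; rewrite link_lab.
have s_root x : \big[addb/false]_(p | s p) (x == root p) = false.
  have [/existsP[q /andP[sq /eqP xq]]|none] := boolP [exists q, s q && (x == root q)].
    have q_lab : lab q != None by apply: contraTneq sq => /eqP/s_lab ->.
    have [v q_v] : exists v, lab q = Some v by case: (lab q) q_lab => // v; exists v.
    rewrite -[RHS](s_blob v) big_mkcond [RHS]big_mkcond /=; apply: eq_bigr => p _.
    have -> : (x == root p) = (lab p == Some v).
      apply/eqP/eqP => [xp|pv]; first by rewrite -root_lab -xp xq root_lab.
      by rewrite xq; apply: root_eq; rewrite // pv.
    by case: (s p); case: eqP.
  rewrite big1 // => p sp; apply: contraNF none => xp.
  by apply/existsP; exists p; rewrite sp.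
have /fin_all_exists[c cP] := tree_path.
pose C' d := Cs d (+) \big[addb/false]_(p | s p) c p d.
exists C'; split.
- move=> d; rewrite /C' Cs_rev; congr (_ (+) _); apply: eq_bigr => p _.
  by have [-> _ _] := cP p.
- move=> x; rewrite /C' big_split /= -/(s x) exchange_big /=.
  rewrite (eq_bigr (fun p => (x == p) (+) (x == root p))) => [|p _]; last first.
    by have [_ _ ->] := cP p.
  rewrite big_split /= s_root addbF (addb_big_pred1 (i0 := x)).
    by rewrite eqxx andbT addbb.
  by move=> p _; rewrite eq_sym => /negbTE.
- move=> d; rewrite /C'; have [//|nSd] := boolP (S d); rewrite Cs_S //=.
  apply: contraTT => nTd; rewrite big1 // => p _.
  by apply: contraNF nTd; have [_ cT _] := cP p; apply: cT.
- move=> x; rewrite /C' Cs_link big1 ?addbF // => p _.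
  apply/negP => cx; have [_ cT _] := cP p.
  by have := cT _ cx; rewrite S_tree.
Qed.

(* The cell function of the lifted chain does not change along the walk: crossing a
   forest edge and turning keeps the cell, and a plain turn crosses a grid edge
   that is not in the chain. *)
Let grid_even_coboundary (C : {ffun arc h -> bool}) :
  (forall x, C (arc_rev h_sym x) = C x) -> even_chain (@arc_org V h) C ->
  exists w : {ffun arc h -> bool},
    (forall x, w (sigma (arc_rev h_sym x)) = w x) /\
    forall x, w x (+) w (arc_rev h_sym x) = C x.
Proof.
move=> C_rev C_even; have [C' [C'_rev C'_even C'_supp C'_link]] := lift_chain C_rev C_even.
have [|W WP] := grid_coboundary C'_rev C'_even.
  move=> d /C'_supp /orP[/existsP[x /eqP<-]|/tree_lab[d_lab _]]; apply: lab_seam => //.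
  by rewrite link_lab.
have W_psi d : ~~ S d -> W (rcell (psi d)) = W (rcell d).
  move=> nSd; rewrite /psi; have [td|ntd] := boolP (tree d).
    by rewrite rcell_drot_drev.
  have := WP d; rewrite (_ : C' d = false); last first.
    by apply/negP => /C'_supp; rewrite (negbTE nSd) (negbTE ntd).
  by case: (W _); case: (W _).
exists [ffun x => W (rcell (link x))]; split=> x; rewrite !ffunE.
  rewrite link_sigma link_rev.
  have [k [-> _ kN]] := first_returnP psi_inj (S_rev (S_link x)).
  transitivity (W (rcell (iter 1 psi (drev (link x))))).
    elim: k kN => // k IHk kN; rewrite iterS W_psi ?kN //.
    by apply: IHk => j lt_j; apply: kN; apply: ltnW.
  by rewrite /= /psi S_tree ?rcell_drot_drev //; apply: S_rev.
rewrite link_rev -C'_link -WP addbC; congr (W _ (+) _).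
by rewrite -(rcell_drot_drev (drev (link x))) drevK.
Qed.

Lemma link_rotation : exists sigma, planar_rotation h_sym sigma.
Proof. by exists sigma; split. Qed.

End Rotation.

End Forest.

Lemma grid_minor_rotation : exists sigma, planar_rotation h_sym sigma.
Proof.
have [depth [par parP]] := forest_data.
have /fin_all_exists[iota0 iota0P] : forall uv : V * V, exists d : dart,
    h uv.1 uv.2 -> lab d.1 = Some uv.1 /\ lab (drev d).1 = Some uv.2.
  case: lab_minor => _ _ ex_link [u v] /=.
  have [/ex_link[p [b [pu pv]]]|_] := boolP (h u v); first by exists (p, b).
  by exists ((0, 0), (false, false)).
pose iota u v := if (enum_rank u < enum_rank v)%N then iota0 (u, v)
                 else drev (iota0 (v, u)).
apply: (link_rotation parP (iota := iota)) => u v uv.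
have [fst_uv snd_uv] := iota0P (u, v) uv.
have [fst_vu snd_vu] : lab (iota0 (v, u)).1 = Some v
    /\ lab (drev (iota0 (v, u))).1 = Some u by apply: iota0P; rewrite h_sym.
rewrite /iota; case: ltngtP => [_|_|/val_inj/enum_rank_inj eq_uv].
- by split.
- by split; rewrite ?drevK.
- by rewrite eq_uv h_irr in uv.
Qed.

End GridMinor.

Lemma arc_revK (V : finType) (h : rel V) (h_sym : symmetric h) :
  involutive (arc_rev h_sym).
Proof. by move=> x; apply: val_inj; case: x => -[]. Qed.

Lemma card_arc_org (V : finType) (h : rel V) (u : V) :
  #|[pred x : arc h | arc_org x == u]| = #|[pred v | h u v]|.
Proof.
rewrite -(card_in_image (f := fun x : arc h => (val x).2)).
  apply: eq_card => v; apply/fintype.imageP/idP => [[x /eqP <- ->]|uv].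
    exact: (valP x).
  by exists (Sub (u, v) uv); rewrite ?inE /arc_org SubK.
move=> x y /eqP xu /eqP yu eq2; apply: val_inj.
rewrite [val x]surjective_pairing [val y]surjective_pairing eq2; congr (_, _).
by rewrite -[LHS]/(arc_org x) xu -yu.
Qed.

(** Kotzig's theorem for rotation systems that satisfy [planar_rotation]. *)
Lemma rotation_light_edge (V : finType) (h : rel V) (h_sym : symmetric h)
    (sigma : arc h -> arc h) :
  irreflexive h -> planar_rotation h_sym sigma -> (exists u v, h u v) ->
  exists u v, h u v /\
    ((#|[pred w | h u w]| <= 2)%N \/
     (#|[pred w | h u w]| + #|[pred w | h v w]| <= 13)%N).
Proof.
move=> h_irr [sigma_inj sigma_org sigma_fix sigma_bd] [u0 [v0 uv0]].
pose deg u := #|[pred w | h u w]|.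
pose bad u v := h u v && ((deg u <= 2)%N || (deg u + deg v <= 13)%N).
have [/existsP[u /existsP[v /andP[uv /orP[du|duv]]]]|none] :=
    boolP [exists u, exists v, bad u v].
- by exists u, v; split=> //; left.
- by exists u, v; split=> //; right.
exfalso; have heavy x : (2 < deg (arc_org x))%N /\
    (13 < deg (arc_org x) + deg (arc_org (arc_rev h_sym x)))%N.
  apply/andP; rewrite !ltnNge -negb_or; apply: contra none => light.
  apply/existsP; exists (arc_org x); apply/existsP.
  exists (arc_org (arc_rev h_sym x)); rewrite /bad light andbT.
  exact: (valP x).
have phi_inj : injective (fun x => sigma (arc_rev h_sym x)).
  by apply: inj_comp sigma_inj (inv_inj (arc_revK h_sym)).
have loopless x : arc_org (arc_rev h_sym x) != arc_org x.
  by apply/eqP => E; have := valP x; rewrite -[(val x).2]/(arc_org (arc_rev h_sym x)) E h_irr.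
have := euler_inequality (arc_revK h_sym) _ phi_inj sigma_bd.
have := @heavy_edges_few_faces rat _ _ (@arc_org V h) (arc_rev h_sym) sigma
  (arc_revK h_sym) loopless _ sigma_inj sigma_org.
move=> H1 H2.
have : (#|arc h| + 2 <= #|arc h|)%N; last by rewrite addn2 ltnNge leqnSn.
have arc_gt0 : (0 < #|arc h|)%N by apply/card_gt0P; exists (Sub (u0, v0) uv0).
have rev_neq x : arc_rev h_sym x != x.
  by apply: contraNneq (loopless x) => ->.
apply: leq_trans (H2 rev_neq arc_gt0) _; apply: H1.
- move=> x y eq1 eq2; apply: val_inj.
  by rewrite [val x]surjective_pairing [val y]surjective_pairing; congr (_, _).
- move=> x; apply/eqP => fix_x; have [] := heavy x.
  rewrite /deg -card_arc_org => + _; rewrite ltnNge => /negP[].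
  rewrite (@leq_trans 1%N) // -(card1 x); apply: subset_leq_card.
  by apply/fintype.subsetP => y; rewrite !inE => /eqP /(sigma_fix x y fix_x) ->.
- by move=> x; rewrite card_arc_org; case: (heavy x).
- by move=> x; rewrite !card_arc_org; case: (heavy x).
Qed.

(** * Grid minors from connected regions *)

Definition adj_in (n : nat) (P : pred (grid_point n)) :=
  [rel p q | [&& P p, P q & grid_adj p q]].

Definition grid_connected (n : nat) (P : pred (grid_point n)) :=
  forall p q, P p -> P q -> connect (adj_in P) p q.

Lemma adj_in_sub n (P Q : pred (grid_point n)) p q :
  (forall x, P x -> Q x) -> connect (adj_in P) p q -> connect (adj_in Q) p q.
Proof.
move=> PQ; apply: connect_sub => x y /and3P[/PQ Qx /PQ Qy xy].
by apply: connect1; rewrite /= Qx Qy.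
Qed.

(** A blob [A v] is given for each vertex and a connecting region [M e] for each edge,
    which may overlap the blobs of its two ends.  To remove the overlap, the part of
    [M e] that is reached from the tail without entering the blob of the head is
    added to the blob of the tail. *)
Section Regions.

Variables (n : nat) (V E : finType) (tl hd : E -> V) (h : rel V).
Variables (A : V -> pred (grid_point n)) (M : E -> pred (grid_point n)).
Hypothesis A_seam : forall v p, A v p -> off_seam p.
Hypothesis M_seam : forall e p, M e p -> off_seam p.
Hypothesis A_disj : forall u v p, A u p -> A v p -> u = v.
Hypothesis M_disj : forall e f p, M e p -> M f p -> e = f.
Hypothesis AM_disj : forall e v p, M e p -> A v p -> v = tl e \/ v = hd e.
Hypothesis A_conn : forall v, grid_connected (A v).
Hypothesis M_conn : forall e, grid_connected (M e).
Hypothesis M_tl : forall e, exists p, M e p /\ A (tl e) p.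
Hypothesis M_hd : forall e, exists p, M e p /\ A (hd e) p.
Hypothesis tl_hd : forall e, tl e != hd e.
Hypothesis h_ends : forall u v, h u v ->
  exists e, (tl e = u /\ hd e = v) \/ (tl e = v /\ hd e = u).

Let N e : pred (grid_point n) := [pred p | M e p && ~~ A (hd e) p].
Let reach e : pred (grid_point n) :=
  [pred p | N e p && [exists q, [&& M e q, A (tl e) q & connect (adj_in (N e)) q p]]].
Let B v : pred (grid_point n) :=
  [pred p | A v p || [exists e, (tl e == v) && reach e p]].
Let lab p := [pick v | B v p].

Let B_disj u v p : B u p -> B v p -> u = v.
Proof.
have A_reach w e : A w p -> reach e p -> w = tl e.
  move=> Aw /andP[/andP[Me nAhd] _]; have [//|wE] := AM_disj Me Aw.
  by rewrite -wE Aw in nAhd.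
move=> /orP[Au|/existsP[e /andP[/eqP<- re]]] /orP[Av|/existsP[f /andP[/eqP<- rf]]].
- exact: A_disj Au Av.
- exact: A_reach.
- by apply/esym/A_reach.
- by case/andP: re => /andP[Me _] _; case/andP: rf => /andP[/(M_disj Me) -> _] _.
Qed.

Let labP v p : (lab p == Some v) = B v p.
Proof.
rewrite /lab; case: pickP => [u Bu|/(_ v) -> //].
by apply/eqP/idP => [[<-]//|Bv]; rewrite (B_disj Bu Bv).
Qed.

Let lab_adj v p q : B v p -> B v q -> grid_adj p q -> connect (blob_adj lab) p q.
Proof.
rewrite -!labP => /eqP pv /eqP qv pq.
by apply: connect1; rewrite /= pv qv eqxx.
Qed.

Let reachB e p : reach e p -> B (tl e) p.
Proof. by move=> re; apply/orP; right; apply/existsP; exists e; rewrite eqxx. Qed.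

Let reach_step e p q : reach e p -> N e q -> grid_adj p q -> reach e q.
Proof.
case/andP => Np /existsP[x /and3P[Mx Ax xp]] Nq pq; rewrite /reach /= Nq.
apply/existsP; exists x; rewrite Mx Ax /=.
by apply: connect_trans xp (connect1 _); rewrite /= Np Nq.
Qed.

Let reach_connect e p : reach e p -> exists2 q, A (tl e) q & connect (blob_adj lab) q p.
Proof.
case/andP=> _ /existsP[q /and3P[Mq Aq qp]]; exists q => //.
have Nq : N e q.
  rewrite /N /= Mq; apply/negP => /(A_disj Aq)/eqP.
  by rewrite (negbTE (tl_hd e)).
have : reach e q.
  by rewrite /reach /= Nq; apply/existsP; exists q; rewrite Mq Aq connect0.
case/connectP: qp => s qs -> rq.
elim: s q qs rq {Mq Aq Nq} => //= x s IHs q /andP[/and3P[_ Nx qx] xs] rq.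
have rx := reach_step rq Nx qx.
apply: connect_trans _ (IHs x xs rx).
by apply: (@lab_adj (tl e)) qx; apply: reachB.
Qed.

Let lab_minor_conn p q : lab p != None -> lab p = lab q ->
  connect (blob_adj lab) p q.
Proof.
case pv: (lab p) => [v|//] _ /esym qv.
have center x : lab x = Some v -> exists2 y, A v y & connect (blob_adj lab) y x.
  move=> /eqP; rewrite labP => /orP[Ax|/existsP[e /andP[/eqP<-]]].
    by exists x.
  exact: reach_connect.
have [x Ax xp] := center p pv; have [y Ay yq] := center q qv.
apply: connect_trans _ yq; apply: (@connect_trans _ _ x).
  by rewrite blob_adj_sym.
apply: connect_sub (A_conn Ax Ay) => a b /and3P[Aa Ab ab].
by apply: (@lab_adj v) ab; apply/orP; left.
Qed.

(* Follow a path of [M e] from the tail to its first point in the blob of the head. *)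
Let link e : exists p b, lab p = Some (tl e) /\ lab (step p b) = Some (hd e).
Proof.
have [q0 [Mq0 Aq0]] := M_tl e; have [q1 [Mq1 Aq1]] := M_hd e.
have Nq0 : N e q0.
  rewrite /N /= Mq0; apply/negP => /(A_disj Aq0)/eqP.
  by rewrite (negbTE (tl_hd e)).
have rq0 : reach e q0.
  by rewrite /reach /= Nq0; apply/existsP; exists q0; rewrite Mq0 Aq0 connect0.
case/connectP: (M_conn Mq0 Mq1) => s.
elim: s q0 rq0 {Mq0 Aq0 Nq0} => /= [|x s IHs] q rq.
  by move=> _ q1E; case/andP: rq => /andP[_]; rewrite -q1E Aq1.
move=> /andP[/and3P[_ Mx qx] xs] lastE.
have [Ax|nAx] := boolP (A (hd e) x); last first.
  by apply: IHs xs lastE; apply: reach_step rq _ qx; rewrite /N /= Mx.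
have /existsP[b /eqP xE] := qx; exists q, b; rewrite -xE; split; apply/eqP.
  by rewrite labP; apply: reachB.
by rewrite labP; apply/orP; left.
Qed.

Lemma grid_minor_of_regions : exists lab : grid_point n -> option V, grid_minor h lab.
Proof.
exists lab; split=> [p|//|u v /h_ends[e [[<- <-]|[<- <-]]]].
- case pv: (lab p) => [v|//] _; move/eqP: pv; rewrite labP.
  by case/orP => [/A_seam //|/existsP[e /andP[_ /andP[/andP[/M_seam]]]]].
- exact: link.
- have [p [b [pt ph]]] := link e; exists (step p b), (b.1, ~~ b.2).
  by rewrite ph (_ : step _ _ = p) //; have [] := drevK (p, b).
Qed.

End Regions.

(** * From a plane drawing to the grid *)

Section Corners.

Variable R : realType.
Implicit Types (x y : R) (z : R * R).

(** In each coordinate, the two integers next to [x]; together they give the corners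
    of a unit cell that contains a point of the plane. *)
Definition corner x (i : nat) := (i == Num.truncn x) || (i == (Num.truncn x).+1).

Lemma corner_near x i : 0 <= x -> corner x i -> `|i%:R - x| <= 1.
Proof.
move=> /truncn_itv/andP[le_x lt_x] /orP[]/eqP->; rewrite ler_norml; move: le_x lt_x;
  rewrite -natr1; lra.
Qed.

Lemma corner_share_near x y : 0 <= x -> 0 <= y -> `|x - y| < 1 ->
  exists2 i, corner x i & corner y i.
Proof.
move=> x0 y0 xy; wlog le_xy : x y x0 y0 xy / x <= y.
  move=> ihw; have [le_xy|/ltW le_yx] := leP x y; first exact: ihw.
  by have [|i] := ihw y x y0 x0 _ le_yx; [rewrite distrC | exists i].
have /andP[le_x lt_x] := truncn_itv x0; have /andP[le_y lt_y] := truncn_itv y0.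
have le_t : (Num.truncn x <= Num.truncn y)%N by apply: le_truncn.
have lt_t : (Num.truncn y < (Num.truncn x).+2)%N.
  rewrite -(ltr_nat R) -2!natr1; move: xy lt_x le_y; rewrite -natr1 ltr_norml.
  clear; lra.
exists (Num.truncn y); rewrite /corner ?eqxx //; move: le_t lt_t.
by clear; lia.
Qed.

Definition in_box (n : nat) z := (0 <= z.1 < n%:R) && (0 <= z.2 < n%:R).

Definition cell_corner n z (p : grid_point n) := corner z.1 p.1 && corner z.2 p.2.

Lemma corner_lt (n : nat) x i : 0 <= x < n%:R -> corner x i -> (i <= n)%N.
Proof.
move=> /andP[x0 x_n]; have lt_n : (Num.truncn x < n)%N.
  by rewrite -(ltr_nat R) (le_lt_trans _ x_n) // truncn_le.
by case/orP => /eqP-> //; apply: ltnW.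
Qed.

Lemma cell_corner_seam n z (p : grid_point n) : in_box n z -> cell_corner z p -> off_seam p.
Proof.
have neq_N1 (i : 'I_n.+2) : (i <= n)%N -> i != -1.
  by move=> le_i; apply: contraTneq le_i => ->; rewrite -ord_N1 inordK // ltnn.
move=> /andP[z1 z2] /andP[/(corner_lt z1) p1 /(corner_lt z2) p2].
by rewrite /off_seam !neq_N1.
Qed.

Lemma corner_inord n x i : 0 <= x < n%:R -> corner x i -> i = (inord i : 'I_n.+2).
Proof.
by move=> xn /(corner_lt xn) le_i; rewrite inordK // ltnS (leq_trans le_i).
Qed.

Lemma cell_corner_share n z z' : in_box n z -> in_box n z' ->
  `|z.1 - z'.1| < 1 -> `|z.2 - z'.2| < 1 ->
  exists2 p : grid_point n, cell_corner z p & cell_corner z' p.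
Proof.
move=> /andP[z1 z2] /andP[z1' z2'] near1 near2.
have [||i ci ci'] := corner_share_near _ _ near1.
- by case/andP: z1.
- by case/andP: z1'.
have [||j cj cj'] := corner_share_near _ _ near2.
- by case/andP: z2.
- by case/andP: z2'.
exists (inord i, inord j); rewrite /cell_corner /=.
  by rewrite -(corner_inord z1 ci) -(corner_inord z2 cj) ci.
by rewrite -(corner_inord z1 ci) -(corner_inord z2 cj) ci'.
Qed.

Lemma cell_corner_near n z z' (p : grid_point n) : in_box n z -> in_box n z' ->
  cell_corner z p -> cell_corner z' p ->
  `|z.1 - z'.1| <= 2 /\ `|z.2 - z'.2| <= 2.
Proof.
have near2 x y i : 0 <= x -> 0 <= y -> corner x i -> corner y i -> `|x - y| <= 2.
  move=> x0 y0 /(corner_near x0) xi /(corner_near y0) yi.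
  move: xi yi; rewrite !ler_norml; clear; lra.
move=> /andP[/andP[z1 _] /andP[z2 _]] /andP[/andP[z1' _] /andP[z2' _]].
by move=> /andP[c1 c2] /andP[c1' c2']; split; apply: near2; eassumption.
Qed.

Lemma corner_adj n x (i i' : 'I_n.+2) : corner x i -> corner x i' ->
  [\/ i = i', i' = i + 1 | i = i' + 1].
Proof.
have succ (k k' : 'I_n.+2) : val k' = (val k).+1 -> k' = k + 1.
  by move=> kk'; rewrite -[k']inord_val -[k in RHS]inord_val -ord_add1 -kk' ?ltn_ord.
move=> /orP[]/eqP ci /orP[]/eqP ci'.
- by apply: Or31; apply: val_inj; rewrite /= ci ci'.
- by apply: Or32; apply: succ; rewrite /= ci ci'.
- by apply: Or33; apply: succ; rewrite /= ci ci'.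
- by apply: Or31; apply: val_inj; rewrite /= ci ci'.
Qed.

Lemma cell_connected n z (P : pred (grid_point n)) (p q : grid_point n) :
  (forall r, cell_corner z r -> P r) ->
  cell_corner z p -> cell_corner z q -> connect (adj_in P) p q.
Proof.
move=> zP; case: p q => [i j] [i' j'] /andP[/= ci cj] /andP[/= ci' cj'].
have cP (a b : 'I_n.+2) : corner z.1 a -> corner z.2 b -> P (a, b).
  by move=> ca cb; apply: zP; rewrite /cell_corner /= ca.
have adj_connect a b : P a -> P b -> grid_adj a b ->
    connect (adj_in P) a b /\ connect (adj_in P) b a.
  move=> Pa Pb ab; have ba : grid_adj b a by rewrite grid_adj_sym.
  by split; apply: connect1; rewrite /= ?Pa ?Pb.
apply: (@connect_trans _ _ (i', j)).
  have [-> //|i'E|iE] := corner_adj ci ci'.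
    have [] // := @adj_connect (i, j) (i', j) (cP _ _ ci cj) (cP _ _ ci' cj).
    by apply/existsP; exists (false, false); rewrite i'E.
  have [] // := @adj_connect (i', j) (i, j) (cP _ _ ci' cj) (cP _ _ ci cj).
  by apply/existsP; exists (false, false); rewrite iE.
have [-> //|j'E|jE] := corner_adj cj cj'.
  have [] // := @adj_connect (i', j) (i', j') (cP _ _ ci' cj) (cP _ _ ci' cj').
  by apply/existsP; exists (true, false); rewrite j'E.
have [] // := @adj_connect (i', j') (i', j) (cP _ _ ci' cj') (cP _ _ ci' cj).
by apply/existsP; exists (true, false); rewrite jE.
Qed.

End Corners.

Section Curves.

Local Open Scope classical_set_scope.
Local Open Scope ring_scope.

Variable R : realType.
Implicit Types (a b s t : R) (f g : R -> R * R).

(** This is connectedness of the segment, in a form that suits the discrete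
    conclusion of [trace_connected]. *)
Lemma segment_locally_constant a b (P : R -> Prop) :
  (forall t, a <= t <= b -> exists2 d : R, 0 < d &
     forall s, a <= s <= b -> `|t - s| < d -> P s <-> P t) ->
  forall s t, a <= s <= b -> a <= t <= b -> P s -> P t.
Proof.
move=> locP s t sab tab Ps.
pose near_set (Q : R -> Prop) : set R := \bigcup_(td in
  [set td : R * R | [/\ a <= td.1 <= b, 0 < td.2, Q td.1 &
     forall s, a <= s <= b -> `|td.1 - s| < td.2 -> P s <-> P td.1]])
  ball td.1 td.2.
have near_open Q : open (near_set Q).
  by apply: bigcup_open => -[x d] /= [_ d0 _ _]; apply: ball_open.
have near_in Q x : a <= x <= b -> Q x -> near_set Q x.
  move=> xab Qx; have [d d0 dP] := locP x xab.
  by exists (x, d) => /=; [split | exact: ballxx].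
have near_P x : a <= x <= b -> near_set P x -> P x.
  by move=> xab [[y d] /= [_ _ Py yP] /yP yx]; apply/yx.
have near_nP x : a <= x <= b -> near_set (fun y => ~ P y) x -> ~ P x.
  by move=> xab [[y d] /= [_ _ Py yP] /yP yx]; rewrite yx.
pose B := [set x | a <= x <= b /\ P x]%classic.
suff BE : B = `[a, b]%classic.
  have : B t by rewrite BE /= in_itv.
  by case.
apply: (@segment_connected R a b B).
- by exists s.
- exists (near_set P) => //; apply/seteqP; split=> [x [xab Px]|x []] /=.
    by rewrite in_itv /=; split=> //; apply: near_in.
  by rewrite in_itv /= => xab /(near_P _ xab).
- exists (~` near_set (fun y => ~ P y))%classic; first exact/open_closedC.
  apply/seteqP; split=> [x [xab Px]|x []] /=.
    by rewrite in_itv /=; split=> // /(near_nP _ xab).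
  rewrite in_itv /= => xab nPx; split=> //; apply: contrapT => nP.
  exact/nPx/near_in.
Qed.

(** Continuity relative to a segment, by coordinates. *)
Definition cont_on a b f := forall t, a <= t <= b -> forall e : R, 0 < e ->
  exists2 d : R, 0 < d & forall s, a <= s <= b -> `|t - s| < d ->
    `|(f t).1 - (f s).1| < e /\ `|(f t).2 - (f s).2| < e.

Definition trace n f a b : pred (grid_point n) :=
  fun p => `[< exists2 t, a <= t <= b & cell_corner (f t) p >].

(** Nearby points of the curve have a common cell corner, so that being joined to a
    given grid point inside the trace is locally constant along the curve. *)
Lemma trace_connected n f a b : cont_on a b f ->
  (forall t, a <= t <= b -> in_box n (f t)) -> grid_connected (@trace n f a b).
Proof.
move=> f_cont f_box p q /asboolP[t tab tp] /asboolP[s sab sq].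
have tr x (r : grid_point n) : a <= x <= b -> cell_corner (f x) r -> trace f a b r.
  by move=> xab xr; apply/asboolP; exists x.
pose P x := forall r : grid_point n, cell_corner (f x) r ->
  connect (adj_in (@trace n f a b)) p r.
have Pt : P t by move=> r; apply: cell_connected tp => r'; apply: tr.
apply: (@segment_locally_constant a b P _ t s) => // {Pt t tab tp s sab sq q} t tab.
have [d d0 dP] := f_cont t tab 1 ltr01.
exists d => // s sab /dP[] // near1 near2.
have [r tr_r sr] := cell_corner_share (f_box t tab) (f_box s sab) near1 near2.
split=> [Ps q tq|Pt q sq].
  apply: connect_trans (Ps r sr) _.
  by apply: cell_connected tr_r tq => r'; apply: tr.
apply: connect_trans (Pt r tr_r) _.
by apply: cell_connected sr sq => r'; apply: tr.
Qed.

Lemma within_cont_on f : {within `[0, 1]%classic, continuous f} -> cont_on 0 1 f.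
Proof.
move=> /subspace_continuousP f_cont t t01 e e0.
have f_t : f @ within `[0, 1] (nbhs t) --> f t by apply: f_cont; rewrite /= in_itv.
have /nbhs_ballP[d /= d0 dP] : nbhs t (fun x => `[0, 1]%classic x -> ball (f t) e (f x)).
  exact: (cvg_ball f_t e0).
by exists d => // s s01 ts; have [] // := dP s ts.
Qed.

Lemma segment_image_compact f a b : {within `[0, 1]%classic, continuous f} ->
  0 <= a -> b <= 1 -> compact (f @` `[a, b]%classic)%classic.
Proof.
move=> f_cont a0 b1; apply: continuous_compact; last exact: segment_compact.
apply: continuous_subspaceW f_cont => x /=; rewrite !in_itv /=.
by move=> /andP[ax xb]; rewrite (le_trans a0) ?(le_trans xb).
Qed.

Lemma compact_disjoint_apart (K L : set (R * R)) : compact K -> compact L ->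
  (forall z, K z -> L z -> False) ->
  exists2 d : R, 0 < d & forall z z', K z -> L z' -> d <= `|z - z'|.
Proof.
move=> cK cL KL; pose D := (K `*` L)%classic.
have [[zz Dzz]|D0] := pselect (exists zz, D zz); last first.
  by exists 1 => // z z' Kz Lz'; case: D0; exists (z, z').
have [|||c] := @compact_EVT_min _ R (fun zz : (R * R) * (R * R) => `|zz.1 - zz.2|) D.
- by exists zz.
- exact: compact_setX.
- apply: continuous_subspaceT => x; apply: cvg_norm; apply: cvgB.
    exact: cvg_fst.
  exact: cvg_snd.
rewrite inE => -[Kc Lc] c_min; exists `|c.1 - c.2|.
  rewrite normr_gt0 subr_eq0; apply/eqP => c12.
  by apply: KL Kc _; rewrite c12.
by move=> z z' Kz Lz'; apply: (c_min (z, z')); rewrite inE.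
Qed.

End Curves.

Section GridTraces.

Variable R : realType.
Local Open Scope classical_set_scope.
Local Open Scope ring_scope.

Lemma compact_bound (K : set (R * R)) : compact K ->
  exists2 M : R, 0 <= M & forall z, K z -> `|z| <= M.
Proof.
move=> cK; have [[z Kz]|K0] := pselect (exists z, K z); last first.
  by exists 0 => // z Kz; case: K0; exists z.
have [|||c] := @compact_EVT_max _ R (fun z : R * R => `|z|) K.
- by exists z.
- exact: cK.
- by apply: continuous_subspaceT => x; apply: cvg_norm; apply: cvg_id.
rewrite inE => Kc c_max; exists `|c| => // y Ky.
by apply: c_max; rewrite inE.
Qed.

Lemma norm_prod_le (z : R * R) : `|z.1| <= `|z| /\ `|z.2| <= `|z|.
Proof. by rewrite prod_normE /= !le_max !lexx orbT. Qed.

Lemma norm_prod_ge (z : R * R) (d : R) : d <= `|z| -> d <= `|z.1| \/ d <= `|z.2|.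
Proof. by rewrite prod_normE /= le_max => /orP. Qed.

(** Finitely many arcs can be replaced by connected sets of grid points that meet
    exactly when the arcs do: disjoint arcs are at distance at least d > 0, and after
    magnification by s >= 3 / d they share no cell corner. *)
Lemma grid_traces (J : finType) (f : J -> R -> R * R) (a b : J -> R) :
  (forall j, {within `[0, 1], continuous (f j)}) ->
  (forall j, 0 <= a j /\ b j <= 1) ->
  exists n (T : J -> pred (grid_point n)),
  [/\ forall j q, T j q -> off_seam q,
      forall j, grid_connected (T j),
      forall j j' t t', a j <= t <= b j -> a j' <= t' <= b j' ->
        f j t = f j' t' -> exists2 q, T j q & T j' q
    & forall j j' q, T j q -> T j' q -> exists t t',
        [/\ a j <= t <= b j, a j' <= t' <= b j' & f j t = f j' t']].
Proof.
move=> f_cont ab01.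
pose K j := f j @` `[a j, b j].
have K_compact j : compact (K j).
  by have [a0 b1] := ab01 j; apply: segment_image_compact.
have K_in j t : a j <= t <= b j -> K j (f j t).
  by move=> tab; exists t => //=; rewrite in_itv.
have /fin_all_exists[M MP] : forall j, exists M : R,
    0 <= M /\ forall t, a j <= t <= b j -> `|f j t| <= M.
  move=> j; have [M M0 MP] := compact_bound (K_compact j).
  by exists M; split=> // t /K_in; apply: MP.
have /fin_all_exists[d dP] : forall jj : J * J, exists d : R, 0 < d /\
    ((forall z, K jj.1 z -> K jj.2 z -> False) ->
     forall z z', K jj.1 z -> K jj.2 z' -> d <= `|z - z'|).
  move=> [j j'] /=; have [disj|] := pselect (forall z, K j z -> K j' z -> False).
    by have [d d0 dP] := compact_disjoint_apart (K_compact j) (K_compact j') disj; exists d.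
  by exists 1; split.
(* Sums serve as bounds for all the terms at once. *)
pose B := \sum_j M j; pose s := 1 + \sum_jj 3 / d jj.
have d_gt0 jj : 0 < d jj by case: (dP jj).
have s_ge jj : 3 <= s * d jj.
  rewrite -ler_pdivrMr // /s (bigD1 jj) //= addrCA lerDl addr_ge0 //.
  by apply: sumr_ge0 => i _; rewrite divr_ge0 // ltW.
have s_gt0 : 0 < s.
  by rewrite ltr_wpDr // sumr_ge0 // => i _; rewrite divr_ge0 // ltW.
have fB j t : a j <= t <= b j -> `|f j t| <= B.
  have [_ fM] := MP j; move=> /fM/le_trans; apply.
  rewrite /B (bigD1 j) //= lerDl sumr_ge0 // => i _.
  by case: (MP i).
pose n := (Num.truncn (s * (B + B))).+1.
pose g j t : R * R := (s * ((f j t).1 + B), s * ((f j t).2 + B)).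
have g_box j t : a j <= t <= b j -> in_box n (g j t).
  move=> /fB f_le; have [f1 f2] := norm_prod_le (f j t).
  have coord x : `|x| <= B -> 0 <= s * (x + B) < n%:R.
    rewrite ler_norml => /andP[Bx xB]; apply/andP; split.
      by apply: mulr_ge0; [exact: ltW | rewrite -lerBlDr sub0r].
    apply: le_lt_trans (truncnS_gt (s * (B + B))).
    by rewrite ler_pM2l // lerD2r.
  by rewrite /in_box /= !coord ?(le_trans _ f_le).
have scale x x' : `|s * (x + B) - s * (x' + B)| = s * `|x - x'|.
  rewrite -[s in RHS]gtr0_norm // -normrM; congr `|_|; ring.
have g_cont j : cont_on (a j) (b j) (g j).
  move=> t tab e e0; have [a0 b1] := ab01 j.
  have in01 x : a j <= x <= b j -> 0 <= x <= 1.
    by move=> /andP[ax xb]; rewrite (le_trans a0) ?(le_trans xb).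
  have [c c0 cP] := within_cont_on (f_cont j) (in01 t tab) (divr_gt0 e0 s_gt0).
  exists c => // x xab tx; have [near1 near2] := cP x (in01 x xab) tx.
  by rewrite /g /= !scale -!ltr_pdivlMl // ![s^-1 * _]mulrC.
exists n, (fun j => trace (g j) (a j) (b j)); split.
- move=> j q /asboolP[t tab tq]; exact: cell_corner_seam (g_box j t tab) tq.
- by move=> j; apply: trace_connected => // t; apply: g_box.
- move=> j j' t t' tab tab' eq_f.
  have gt : g j t = g j' t' by rewrite /g eq_f.
  have box := g_box j t tab.
  have [||q q1 q2] := cell_corner_share box box; rewrite ?subrr ?normr0 //.
  exists q; apply/asboolP; first by exists t.
  by exists t' => //; rewrite -gt.
- move=> j j' q /asboolP[t tab tq] /asboolP[t' tab' tq'].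
  have [g1 g2] := cell_corner_near (g_box j t tab) (g_box j' t' tab') tq tq'.
  apply: contrapT => no_meet.
  have disj z : K j z -> K j' z -> False.
    move=> [x xab <-] [x' xab' eq_f]; apply: no_meet; exists x, x'.
    by rewrite /= !in_itv in xab xab'; split.
  have [_ /(_ disj _ _ (K_in j t tab) (K_in j' t' tab'))/norm_prod_ge[]] := dP (j, j').
  - rewrite -(ler_pM2l s_gt0) -scale; move: g1 (s_ge (j, j')); rewrite /g /=.
    by move=> g1 s3 s_d; have := le_trans s3 (le_trans s_d g1); rewrite ler_nat.
  - rewrite -(ler_pM2l s_gt0) -scale; move: g2 (s_ge (j, j')); rewrite /g /=.
    by move=> g2 s3 s_d; have := le_trans s3 (le_trans s_d g2); rewrite ler_nat.
Qed.

End GridTraces.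

Section PlanarGridMinor.

Variables (R : realType) (G : sgraph).
Local Open Scope classical_set_scope.
Local Open Scope ring_scope.

Let third_lo (k : option bool) : R :=
  match k with Some false => 0 | None => 1/3 | Some true => 2/3 end.
Let third_hi (k : option bool) : R :=
  match k with Some false => 1/3 | None => 2/3 | Some true => 1 end.

(** The outer thirds of the arcs at a vertex form its blob, the middle thirds are
    the connecting regions. *)
Lemma planar_grid_minor : planar R G ->
  exists n (lab : grid_point n -> option G), grid_minor (@sedge G) lab.
Proof.
move=> [p [gamma [p_inj gammaP gamma_ends gamma_p gamma_disj]]].
have gamma_inj e s t : 0 <= s <= 1 -> 0 <= t <= 1 -> gamma e s = gamma e t -> s = t.
  by move=> s01 t01; have [_] := gammaP e; apply; rewrite in_itv.
have /fin_all_exists[ends endsP] : forall e : edge_of G, exists uv : G * G,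
    [/\ gamma e 0 = p uv.1, gamma e 1 = p uv.2, uv.1 \in val e, uv.2 \in val e
      & uv.1 != uv.2].
  move=> e; have sub t : t = 0 \/ t = 1 -> exists2 u, u \in val e & p u = gamma e t.
    move=> t01; have : (gamma e @` [set 0; 1]) (gamma e t) by exists t.
    by rewrite gamma_ends => -[u /= ue pu]; exists u.
  have [u ue pu] := sub 0 (or_introl erefl); have [v ve pv] := sub 1 (or_intror erefl).
  exists (u, v); split=> //=; apply/eqP => uv.
  have /eqP : (0 : R) = 1 by apply: (gamma_inj e); rewrite ?lexx ?ler01 // -pu -pv uv.
  by rewrite eq_sym oner_eq0.
pose end_of e (k : bool) := if k then (ends e).2 else (ends e).1.
pose param (k : bool) : R := if k then 1 else 0.
have end_gamma e k : gamma e (param k) = p (end_of e k).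
  by have [e0 e1 _ _ _] := endsP e; case: k.
have [n [T [T_seam T_conn T_meet T_disj]]] :=
  @grid_traces R (edge_of G * option bool)%type (fun j => gamma j.1)
    (fun j => third_lo j.2) (fun j => third_hi j.2)
    (fun j => proj1 (gammaP j.1)) (ltac:(by move=> [e [[]|]] /=; split; lra)).
have arc_disj e k f l q : T (e, k) q -> T (f, l) q -> exists s t,
    [/\ third_lo k <= s <= third_hi k, third_lo l <= t <= third_hi l
      & gamma e s = gamma f t] := T_disj (e, k) (f, l) q.
have third01 k t : third_lo k <= t <= third_hi k -> 0 <= t <= 1.
  by case: k => [[]|] /= /andP[]; lra.
have middle t : third_lo None <= t <= third_hi None -> 0 < t < 1.
  by move=> /= /andP[]; lra.
(* Two arcs have only ends in common; an arc does not meet itself. *)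
have meet e f s t : 0 <= s <= 1 -> 0 <= t <= 1 -> gamma e s = gamma f t ->
    (e = f /\ s = t) \/ (exists k l, [/\ s = param k, t = param l & end_of e k = end_of f l]).
  have inner x : 0 <= x <= 1 -> 0 < x < 1 \/ exists k, x = param k.
    move=> /andP[x0 x1]; have [->|nx0] := eqVneq x 0; first by right; exists false.
    have [->|nx1] := eqVneq x 1; first by right; exists true.
    by left; rewrite !lt_neqAle x0 x1 nx1 eq_sym nx0.
  move=> s01 t01 st; case: (inner s s01) => [s_in|[k sk]]; case: (inner t t01) => [t_in|[l tl]].
  - left; have [ef|ef] := eqVneq e f; last by case: (gamma_disj _ _ _ _ ef s_in t_in).
    by split=> //; apply: (gamma_inj e) => //; rewrite st ef.
  - by case: (gamma_p e s (end_of f l) s_in); rewrite st tl end_gamma.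
  - by case: (gamma_p f t (end_of e k) t_in); rewrite -st sk end_gamma.
  - right; exists k, l; split=> //; apply: p_inj.
    by rewrite -!end_gamma -sk -tl.
pose A v : pred (grid_point n) :=
  fun q => [exists e, exists k, (end_of e k == v) && T (e, Some k) q].
pose M e : pred (grid_point n) := T (e, None).
have third_param k l t : third_lo (Some k) <= t <= third_hi (Some k) -> t = param l -> k = l.
  by case: k; case: l => /= /andP[] lo hi tE //; move: lo hi; rewrite tE; lra.
exists n; apply: (@grid_minor_of_regions n G (edge_of G) (end_of ^~ false) (end_of ^~ true) _ A M).
- by move=> v q /existsP[e /existsP[k /andP[_]]]; apply: T_seam.
- by move=> e q; apply: T_seam.
- move=> u v q /existsP[e /existsP[k /andP[/eqP<- Tk]]].
  move=> /existsP[f /existsP[l /andP[/eqP<- Tl]]].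
  have [s [t [sk tl st]]] := arc_disj _ _ _ _ _ Tk Tl.
  case: (meet e f s t (third01 _ _ sk) (third01 _ _ tl) st) => [[<- st']|[k' [l' [sk' tl' kl]]]].
    congr end_of; move: sk tl; rewrite -st' /=.
    by case: (k); case: (l) => //= /andP[+ +] /andP[+ +]; lra.
  by rewrite (third_param k k' s) // (third_param l l' t).
- move=> e f q Te Tf; have [s [t [sk tl st]]] := arc_disj _ _ _ _ _ Te Tf.
  case: (meet e f s t (third01 None _ sk) (third01 None _ tl) st) => [[]//|[k [l [sk' _ _]]]].
  by have := middle s sk; rewrite sk'; case: (k) => /=; rewrite ltxx ?andbF.
- move=> e v q Te /existsP[f /existsP[l /andP[/eqP<- Tl]]].
  have [s [t [sk tl st]]] := arc_disj _ _ _ _ _ Te Tl.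
  case: (meet e f s t (third01 None _ sk) (third01 _ _ tl) st) => [[<- _]|[k [l' [sk' _ _]]]].
    by case: (l); [right|left].
  by have := middle s sk; rewrite sk'; case: (k) => /=; rewrite ltxx ?andbF.
- move=> v q r /existsP[e /existsP[k /andP[/eqP ek Tq]]].
  move=> /existsP[f /existsP[l /andP[/eqP fl Tr]]].
  have [|||x Tx Tx'] := T_meet (e, Some k) (f, Some l) (param k) (param l).
  + by case: (k) => /=; lra.
  + by case: (l) => /=; lra.
  + by rewrite /= !end_gamma ek fl.
  have TA g m y : end_of g m = v -> T (g, Some m) y -> A v y.
    by move=> gm Ty; apply/existsP; exists g; apply/existsP; exists m; rewrite gm eqxx.
  apply: (@connect_trans _ _ x).
    by apply: adj_in_sub (T_conn _ _ _ Tq Tx) => y; apply: TA.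
  by apply: adj_in_sub (T_conn _ _ _ Tx' Tr) => y; apply: TA.
- by move=> e; apply: T_conn.
- move=> e; have [|||q q1 q2] := T_meet (e, None) (e, Some false) (1/3) (1/3) => //=.
  + by lra.
  + by lra.
  exists q; split=> //; apply/existsP; exists e; apply/existsP; exists false.
  by rewrite eqxx.
- move=> e; have [|||q q1 q2] := T_meet (e, None) (e, Some true) (2/3) (2/3) => //=.
  + by lra.
  + by lra.
  exists q; split=> //; apply/existsP; exists e; apply/existsP; exists true.
  by rewrite eqxx.
- by move=> e; have [_ _ _ _] := endsP e.
- move=> u v uv.
  have e_edge : [set u; v]%SET \in edge_set G.
    by rewrite inE; apply/existsP; exists u; apply/existsP; exists v; rewrite uv eqxx.
  pose e : edge_of G := Sub [set u; v]%SET e_edge.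
  exists e; have [_ _ + + neq] := endsP e; rewrite /= !inE.
  move=> /orP[]/eqP e1 /orP[]/eqP e2; move: neq; rewrite /end_of ?e1 ?e2 ?eqxx // => _.
    by left.
  by right.
Qed.

End PlanarGridMinor.

(** * Colouring the line graph greedily *)

Lemma fresh_colour (A : zmodType) (L : set A) (k : nat) (s : seq A) :
  (L #= `I_k)%card -> (size s < k)%N -> exists2 a, L a & a \notin s.
Proof.
move=> cardL lt_s; apply: contrapT => no_a.
have sub : (L `<=` [set` s])%classic.
  move=> a La /=; apply: contrapT => /negP nas.
  by apply: no_a; exists a.
have /card_le_trans/(_ (card_le_seq s)) := subset_card_le sub.
by rewrite (card_le_eql cardL) card_le_II leqNgt lt_s.
Qed.

(** Greedy colouring: a coloured neighbour excludes exactly one value, whatever the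
    orientation and the shift [f] of the edge. *)
Lemma degenerate_group_choosable (H : sgraph) (k : nat) :
  (forall W : {set H}, W != finset.set0 ->
     exists2 v, v \in W & (#|[set y in W | sedge v y]| < k)%N) ->
  group_choosable H k.
Proof.
move=> degen A _ L cardL D [Dedge Dor] f.
have Dxx x : D x x = false.
  by apply/negP => /Dedge; rewrite sedge_irrefl.
pose val_f x y := if [pick e : edge_of H | val e == [set x; y]%SET] is Some e
                  then f e else 0.
have val_fP (e : edge_of H) x y : val e = [set x; y]%SET -> val_f x y = f e.
  rewrite /val_f => exy; case: pickP => [e' /eqP e'xy|/(_ e)].
    by congr f; apply: val_inj; rewrite e'xy exy.
  by rewrite exy eqxx.
suff main n (W : {set H}) : #|W| = n -> exists c : H -> A,
    (forall v, v \in W -> L v (c v)) /\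
    forall x y, x \in W -> y \in W -> D x y -> c x - c y <> val_f x y.
  have [c [cL cf]] := main _ [set: H]%SET erefl.
  exists c; split=> [v|e x y Dxy exy]; first by apply: cL; rewrite inE.
  by rewrite -(val_fP _ _ _ exy); apply: cf => //; rewrite inE.
elim: n W => [|n IHn] W cardW.
  exists (fun=> 0); have W0 v : v \in W = false by rewrite (cards0_eq cardW) inE.
  by split=> [v|x y]; rewrite W0.
have [|v vW dv] := degen W; first by rewrite -card_gt0 cardW.
have [|c [cL cf]] := IHn (W :\ v).
  by have := cardsD1 v W; rewrite vW cardW => -[].
pose bad y := if D v y then val_f v y + c y else c y - val_f y v.
have [|a La a_bad] := @fresh_colour A (L v) k
    [seq bad y | y <- enum [set y in W | sedge v y]] (cardL v).
  by rewrite size_map -cardE.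
have badP y : y \in W -> sedge v y -> a <> bad y.
  move=> yW vy ay; case/mapP: a_bad; exists y => //.
  by rewrite mem_enum inE yW.
exists (fun x => if x == v then a else c x); split=> [x xW|x y xW yW Dxy].
  by case: eqP => [-> //|/eqP xv]; apply: cL; rewrite !inE xv.
have [xv|xv] := eqVneq x v; last first.
  have [yv|yv] := eqVneq y v; last by apply: cf => //; rewrite !inE ?xv ?yv.
  move=> eqf; subst y; apply: (badP x xW); first by rewrite sedge_sym Dedge.
  rewrite /bad; have := Dor _ _ (Dedge _ _ Dxy).
  by rewrite Dxy => /esym/negbTE ->; rewrite -eqf subKr.
subst x; have [yv|yv] := eqVneq y v; first by rewrite yv Dxx in Dxy.
move=> eqf; apply: (badP y yW); first exact: Dedge.
by rewrite /bad Dxy -eqf subrK.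
Qed.

Lemma grid_minor_sub (n : nat) (V : finType) (h h' : rel V)
    (lab : grid_point n -> option V) :
  (forall u v, h' u v -> h u v) -> grid_minor h lab -> grid_minor h' lab.
Proof. by move=> sub [seam conn link]; split=> // u v /sub/link. Qed.

Section LineGraph.

Variables (R : realType) (G : sgraph) (planarG : planar R G).

(** The edge uv given by [rotation_light_edge] in the subgraph with edge set [W] has
    at most (deg u - 1) + (deg v - 1) neighbours in [W]: at most Delta if an end
    has degree at most 2, and at most 11 otherwise. *)
Lemma planar_line_graph_light (W : {set line_graph G}) : W != finset.set0 ->
  exists2 e, e \in W & forall k, (max_degree G < k)%N -> (12 <= k)%N ->
    (#|[set f in W | sedge e f]%SET| < k)%N.
Proof.
move=> /set0Pn[e0 e0W].
pose h : rel G := fun u v => [exists e, (e \in W) && (val e == [set u; v]%SET)].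
have edgeP (e : edge_of G) : exists x y, sedge x y /\ val e = [set x; y]%SET.
  by have := valP e; rewrite inE => /existsP[x /existsP[y /andP[xy /eqP]]]; exists x, y.
have h_sedge u v : h u v -> sedge u v.
  move=> /existsP[e /andP[_ /eqP eE]]; have [x [y [xy eE']]] := edgeP e.
  have xy_neq : x != y by apply: contraTneq xy => ->; rewrite sedge_irrefl.
  have : [set x; y]%SET = [set u; v]%SET by rewrite -eE'.
  move/setP=> uvE; have := uvE x; have := uvE y; rewrite !inE !eqxx orbT /=.
  move=> /esym/orP[]/eqP yE /esym/orP[]/eqP xE; move: xy xy_neq;
    rewrite xE yE ?eqxx //; by rewrite sedge_sym.
have h_sym : symmetric h.
  by move=> u v; apply: eq_existsb => e; rewrite finset.setUC.
have h_irr : irreflexive h.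
  by move=> u; apply: contraTF isT => /h_sedge; rewrite sedge_irrefl.
have [n [lab /(grid_minor_sub h_sedge) lab_minor]] := planar_grid_minor planarG.
have [sigma sigma_rot] := grid_minor_rotation h_sym h_irr lab_minor.
have [|u [v [uv light]]] := rotation_light_edge h_irr sigma_rot.
  have [x [y [xy eE]]] := edgeP e0; exists x, y.
  by apply/existsP; exists e0; rewrite e0W eE eqxx.
have /existsP[e /andP[eW /eqP eE]] := uv.
exists e => // k lt_k k12.
pose star x := [set f in W | x \in val f]%SET.
have card_star x : (#|star x| <= #|[pred w | h x w]|)%N.
  rewrite -(card_imset (mem (star x)) val_inj) -(cardsE [pred w | h x w]).
  apply: leq_trans (leq_imset_card (fun w => [set x; w]%SET) _).
  apply: subset_leq_card; apply/fintype.subsetP => _ /imsetP[f + ->].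
  rewrite inE => /andP[fW xf]; have [y [z [yz fE]]] := edgeP f.
  have [w fE'] : exists w, val f = [set x; w]%SET.
    move: xf; rewrite fE !inE => /orP[]/eqP->; first by exists z.
    by exists y; rewrite finset.setUC.
  apply/imsetP; exists w => //; rewrite !inE; apply/existsP; exists f.
  by rewrite fW fE' eqxx.
have e_star x : x \in val e -> e \in star x by move=> xe; rewrite inE eW.
have ue : u \in val e by rewrite eE !inE eqxx.
have ve : v \in val e by rewrite eE !inE eqxx orbT.
have : (#|[set f in W | sedge e f]%SET| <= #|star u :\ e| + #|star v :\ e|)%N.
  apply: leq_trans (leq_card_setU _ _); apply: subset_leq_card.
  apply/fintype.subsetP => f; rewrite !inE => /andP[fW /andP[neq /existsP[x /andP[]]]].
  by rewrite eE !inE [f == e]eq_sym neq fW /= => /orP[]/eqP-> ->; rewrite ?orbT.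
have card_u := card_star u; have card_v := card_star v.
rewrite (cardsD1 e (star u)) e_star // in card_u.
rewrite (cardsD1 e (star v)) e_star // in card_v.
have h_max x : (#|[pred w | h x w]| <= max_degree G)%N.
  apply: leq_trans (leq_bigmax x); apply: subset_leq_card.
  by apply/fintype.subsetP => w; apply: h_sedge.
move: (h_max v) light card_u card_v lt_k k12; clear.
set a := #|_|; set b := #|_|; set c := #|_|; set d := #|_|; set m := #|_|; lia.
Qed.

Lemma planar_edge_chi_gl k :
  (max_degree G < k)%N -> (12 <= k)%N -> (edge_chi_gl G <= k)%N.
Proof.
move=> lt_k k12; rewrite /edge_chi_gl /chi_gl; case: ex_minnP => m _; apply.
apply/asboolP; apply: degenerate_group_choosable => W /planar_line_graph_light[e eW light].
by exists e => //; apply: light.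
Qed.

End LineGraph.

Theorem corollary2p8 (R : realType) (G : sgraph) (hG : planar R G) :
  ((11 <= max_degree G)%N -> (edge_chi_gl G <= max_degree G + 1)%N) /\
  ((10 <= max_degree G)%N -> (edge_chi_gl G <= max_degree G + 2)%N).
Proof.
by split=> large; apply: (planar_edge_chi_gl hG); lia.
Qed.
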